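(* Let $\Phi_2$ be the root system of type $G_2$ with simple roots $\alpha_1$ (short) and $\alpha_2$ (long) and positive roots $\alpha_1$, $\alpha_2$, $\alpha_3=\alpha_1+\alpha_2$, $\alpha_4=2\alpha_1+\alpha_2$, $\alpha_5=3\alpha_1+\alpha_2$, $\alpha_6=3\alpha_1+2\alpha_2$. Let $q$ be a power of a prime $p>3$ and $UG_2=UG_2(q)$. Choose arms $a(\alpha_1)=a(\alpha_2)=\emptyset$, $a(\alpha_3)=a(\alpha_4)=a(\alpha_5)=\{\alpha_1\}$, $a(\alpha_6)=\{\alpha_2,\alpha_3\}$, and let $S_\alpha$, $\overline{T}_\alpha$ be the associated groups. For each $\alpha\in\Phi_2^+$ the map $$\Psi_\alpha:\operatorname{Irr}(\overline{T}_\alpha)\times\operatorname{Irr}(X_\alpha)^*\to\operatorname{Irr}(UG_2)_\alpha,\qquad(\mu,\lambda)\mapsto\bigl(\operatorname{Infl}_{\overline{T}_\alpha}^{S_\alpha}\mu\cdot\operatorname{Infl}_{X_\alpha}^{S_\alpha}\lambda\bigr)^{UG_2}$$ is a one to one correspondence. The number of midafis $|\operatorname{Irr}^{\mathrm{mida}}(UG_2)_\alpha|$ and their common degree are: $q-1$ and $1$ for $\alpha_1$; $q-1$ and $1$ for $\alpha_2$; $q-1$ and $q$ for $\alpha_3$; $q(q-1)$ and $q$ for $\alpha_4$; $q^2(q-1)$ and $q$ for $\alpha_5$; $q(q-1)$ and $q^2$ for $\alpha_6$.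
   Context: $X_\gamma=\{x_\gamma(t)\mid t\in\mathbb{F}_q\}$ ($\gamma\in\Phi_2^+$) are the root subgroups of the Chevalley group $G_2(q)$, and $UG_2=\langle X_\gamma\mid\gamma\in\Phi_2^+\rangle$. A set $S\subseteq\Phi_2^+$ is a closed pattern if $\beta,\gamma\in S$, $\beta+\gamma\in\Phi_2^+$ imply $\beta+\gamma\in S$; then $P(S)=\langle X_\gamma\mid\gamma\in S\rangle$. $k(\alpha)$ is the largest subset $N\subseteq\Phi_2^+$ with $\alpha\notin N$ that is normal, i.e. such that $\beta\in N$, $\gamma\in\Phi_2^+$, $\beta+\gamma\in\Phi_2^+$ imply $\beta+\gamma\in N$ (equivalently, $k(\alpha)$ is the set of $\beta\in\Phi_2^+$ such that $\alpha-\beta$ is neither $0$ nor a sum of positive roots). The hook is $h(\alpha)=\{\gamma\in\Phi_2^+\mid\alpha-\gamma\in\Phi_2^+\cup\{0\}\}$, the leg is $\ell(\alpha)=h(\alpha)\setminus(\{\alpha\}\cup a(\alpha))$, the source is $s(\alpha)=\Phi_2^+\setminus a(\alpha)$ (a closed pattern), $S_\alpha=P(s(\alpha))$, $\overline{T}_\alpha=S_\alpha/P(\{\alpha\}\cup\ell(\alpha)\cup k(\alpha))$. The group $X_\alpha$ is identified with $S_\alpha/P(s(\alpha)\setminus\{\alpha\})$, and $\operatorname{Infl}_{X_\alpha}^{S_\alpha}$ is inflation along this quotient. $\operatorname{Irr}(G)$: complex irreducible characters; $\operatorname{Irr}(G)^*=\operatorname{Irr}(G)\setminus\{\mathbf{1}_G\}$;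 $\lambda^U$: induction. For $\chi\in\operatorname{Irr}(UG_2)$, $\operatorname{rs}(\chi)=\{\gamma\in\Phi_2^+\mid X_\gamma\subseteq Z(\chi),X_\gamma\not\subseteq\ker\chi\}$; $\operatorname{Irr}(UG_2)_\alpha=\{\chi\mid\operatorname{rs}(\chi)=\{\alpha\}\}$; $\operatorname{Irr}^{\mathrm{mida}}(UG_2)_\alpha$ is its subset of characters of minimal degree (midafis for $\alpha$). *)

(* Defs.v *)
From HB Require Import structures.
From mathcomp Require Import all_boot all_order all_algebra all_fingroup.
From mathcomp Require Import all_solvable all_field all_character.

Set Implicit Arguments.
Unset Strict Implicit.
Unset Printing Implicit Defensive.

Import Order.TTheory GRing.Theory Num.Theory.
Local Open Scope ring_scope.

(* [a_i] is the positive root alpha_i. *)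
Inductive posroot := a1 | a2 | a3 | a4 | a5 | a6.

Definition posroot_code (g : posroot) : 'I_6 :=
  inord (match g with a1 => 0 | a2 => 1 | a3 => 2 | a4 => 3 | a5 => 4
         | a6 => 5 end).
Definition posroot_decode (i : 'I_6) : posroot :=
  nth a1 [:: a1; a2; a3; a4; a5; a6] i.
Lemma posroot_codeK : cancel posroot_code posroot_decode.
Proof. by case; rewrite /posroot_decode inordK. Qed.
HB.instance Definition _ := Finite.copy posroot (can_type posroot_codeK).

(* The pair (m, n) stands for m alpha_1 + n alpha_2. *)
Definition rcoord (g : posroot) : int * int :=
  match g with
  | a1 => (1, 0) | a2 => (0, 1) | a3 => (1, 1)
  | a4 => (2, 1) | a5 => (3, 1) | a6 => (3, 2)
  end.

Section ChevalleyBasis.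
Local Open Scope int_scope.

(* The squared length, with (alpha_1, alpha_1) = 2, (alpha_2, alpha_2) = 6 and
   (alpha_1, alpha_2) = -3. *)
Definition rnorm (r : int * int) : int :=
  2%Z * r.1 * r.1 - 6%Z * r.1 * r.2 + 6%Z * r.2 * r.2.

Definition pos_coords : seq (int * int) :=
  [seq rcoord g | g <- [:: a1; a2; a3; a4; a5; a6]].
Definition is_root (r : int * int) : bool :=
  (r \in pos_coords) || (- r \in pos_coords).

(* Structure constants N_{r,s} for r, s positive.  The signs on the extraspecial
   pairs are chosen to be +; the value for (alpha_3, alpha_4) is then forced. *)
Definition Npos (r s : int * int) : int :=
  let half (r s : int * int) : int :=
    if (r == (1, 0)) && (s == (0, 1)) then 1
    else if (r == (1, 0)) && (s == (1, 1)) then 2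
    else if (r == (1, 0)) && (s == (2, 1)) then 3
    else if (r == (0, 1)) && (s == (3, 1)) then 1
    else if (r == (1, 1)) && (s == (2, 1)) then - (3 : int)
    else 0 in
  half r s - half s r.

(* The other structure constants, from N_{-r,-s} = - N_{r,s}, N_{s,r} = - N_{r,s}
   and N_{r,s}/(t,t) = N_{s,t}/(r,r) = N_{t,r}/(s,s) when r + s + t = 0. *)
Definition Nmixed (r s : int * int) : int :=
  let t := r + s in
  if t \in pos_coords then - ((rnorm t * Npos (- s) t) %/ rnorm r)%Z
  else ((rnorm t * Npos (- t) r) %/ rnorm s)%Z.

Definition Nstruct (r s : int * int) : int :=
  if ~~ [&& is_root r, is_root s & is_root (r + s)] then 0 else
  match r \in pos_coords, s \in pos_coords with
  | true, true => Npos r s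
  | false, false => - Npos (- r) (- s)
  | true, false => Nmixed r s
  | false, true => - Nmixed s r
  end.

(* [inl r] is the root vector e_r; [inr false] and [inr true] are the simple
   coroots h_{alpha_1} and h_{alpha_2}. *)
Definition chev := ((int * int) + bool)%type.
Definition E (r : int * int) : chev := inl r.
Definition H1 : chev := inr false.
Definition H2 : chev := inr true.

(* Ordered by increasing height, so that positive root vectors act by strictly
   lower triangular matrices on column vectors. *)
Definition chev_basis : seq chev :=
  [seq E (- rcoord g) | g <- [:: a6; a5; a4; a3; a2; a1]]
  ++ [:: H1; H2] ++ [seq E (rcoord g) | g <- [:: a1; a2; a3; a4; a5; a6]].

(* The pairing of the root s with the coroot of alpha_1, resp. alpha_2. *)
Definition cartan (i : bool) (s : int * int) : int :=
  if i then - s.1 + 2%Z * s.2 else 2%Z * s.1 - 3%Z * s.2.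

(* The bracket of two basis elements, as a linear combination of basis elements;
   [e_r, e_{-r}] = h_r = (2m/(r,r)) h_1 + (6n/(r,r)) h_2 for r = (m, n). *)
Definition bracket (x y : chev) : seq (int * chev) :=
  match x, y with
  | inl r, inl s =>
      if s == - r then
        [:: (((2%Z * r.1) %/ rnorm r)%Z, H1); (((6%Z * r.2) %/ rnorm r)%Z, H2)]
      else if is_root (r + s) then [:: (Nstruct r s, E (r + s))] else [::]
  | inr i, inl s => [:: (cartan i s, E s)]
  | inl r, inr i => [:: (- cartan i r, E r)]
  | inr _, inr _ => [::]
  end.

Definition coef (z : chev) (v : seq (int * chev)) : int :=
  foldr (fun cu s => (if cu.2 == z then cu.1 else 0) + s) 0 v.

Definition bracket_lin (x : chev) (v : seq (int * chev)) : seq (int * chev) :=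
  flatten [seq [seq (cu.1 * dw.1, dw.2) | dw <- bracket x cu.2] | cu <- v].

Lemma bracket_antisym :
  all (fun x => all (fun y => all (fun w =>
    coef w (bracket x y ++ bracket y x) == 0)
  chev_basis) chev_basis) chev_basis.
Proof. by vm_compute. Qed.

Lemma bracket_jacobi :
  all (fun x => all (fun y => all (fun z =>
    let v := bracket_lin x (bracket y z) ++ bracket_lin y (bracket z x)
             ++ bracket_lin z (bracket x y) in
    all (fun w => coef w v == 0) (map snd v))
  chev_basis) chev_basis) chev_basis.
Proof. by vm_compute. Qed.

(* |N_{r,s}| = p + 1, where p is the largest integer such that s - p r is a
   root. *)
Lemma Nstruct_chevalley :
  all (fun r => all (fun s => is_root (r + s) ==>
    (`|Nstruct r s|%N ==
      (is_root (s - r)%R + (is_root (s - r)%R && is_root (s - r - r)%R)).+1)%N)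
  (pos_coords ++ map -%R pos_coords)) (pos_coords ++ map -%R pos_coords).
Proof. by vm_compute. Qed.

End ChevalleyBasis.

Section RootCombinatorics.
Implicit Types (g al : posroot) (N : {set posroot}).

(* b + c = d in the root lattice. *)
Definition rsum (b c d : posroot) : bool := rcoord b + rcoord c == rcoord d.

Definition arm al : {set posroot} :=
  match al with
  | a1 | a2 => set0
  | a3 | a4 | a5 => [set a1]
  | a6 => [set a2; a3]
  end.

Definition hook al : {set posroot} :=
  [set g | (g == al) || [exists d, rsum g d al]].
Definition leg al : {set posroot} := hook al :\: (al |: arm al).
Definition source al : {set posroot} := ~: arm al.

Definition normal_pattern N : bool :=
  [forall b in N, forall c, forall d, rsum b c d ==> (d \in N)].
Definition kpattern al : {set posroot} :=
  \bigcup_(N : {set posroot} | normal_pattern N && (al \notin N)) N.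

Lemma kpattern_normal al : normal_pattern (kpattern al).
Proof.
apply/forall_inP=> b /bigcupP[N nN Nb]; apply/forallP=> c; apply/forallP=> d.
apply/implyP=> bcd; apply/bigcupP; exists N => //.
have [/forall_inP/(_ b Nb)/forallP/(_ c)/forallP/(_ d)/implyP/(_ bcd)] := andP nN.
by [].
Qed.

Lemma kpattern_notin al : al \notin kpattern al.
Proof. by apply/bigcupP=> -[N /andP[_ /negP]]. Qed.

Lemma kpattern_max al N :
  normal_pattern N -> al \notin N -> N \subset kpattern al.
Proof. by move=> nN alN; apply: bigcup_sup; rewrite nN. Qed.

End RootCombinatorics.

Section RootSubgroups.
Variable F : finFieldType.

(* The action of e_g in the adjoint representation on the Lie algebra of type
   G_2 over F, on column vectors of coordinates in [chev_basis]. *)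
Definition ad_root (g : posroot) : 'M[F]_14 :=
  \matrix_(i, j) (coef (nth H1 chev_basis i)
                    (bracket (E (rcoord g)) (nth H1 chev_basis j)))%:~R.

(* exp (t ad e_g); the series stops at degree 3 because (ad e_g)^4 = 0.  The
   denominators are invertible when the characteristic of F is > 3. *)
Definition exp_ad (g : posroot) (t : F) : 'M[F]_14 :=
  \sum_(k < 4) (t ^+ k / (k`!)%:R) *: ad_root g ^+ k.

Lemma ad_root_lower g (i j : 'I_14) : (i <= j)%N -> ad_root g i j = 0.
Proof.
rewrite mxE => le_ij.
have h : all (fun k => all (fun l => (k <= l)%N ==>
    (coef (nth H1 chev_basis k)
       (bracket (E (rcoord g)) (nth H1 chev_basis l)) == 0))
    (iota 0 14)) (iota 0 14) by case: g; vm_compute.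
have /allP/(_ (val j)) := allP h (val i) ltac:(by rewrite mem_iota ltn_ord).
by rewrite mem_iota ltn_ord le_ij => /(_ isT)/eqP->.
Qed.

Lemma ad_rootX_lower g k (i j : 'I_14) :
  (i <= j)%N -> (ad_root g ^+ k.+1) i j = 0.
Proof.
elim: k i j => [|k IHk] i j le_ij; first exact: ad_root_lower.
rewrite exprS mxE big1 // => l _.
have [le_il | lt_li] := leqP i l; first by rewrite ad_root_lower ?mul0r.
by rewrite IHk ?mulr0 // (leq_trans (ltnW lt_li)).
Qed.

Lemma exp_ad_unit g t : exp_ad g t \in unitmx.
Proof.
have expE (i j : 'I_14) : (i <= j)%N -> exp_ad g t i j = (i == j)%:R.
  move=> le_ij; rewrite summxE big_ord_recl big1 => [|k _].
    by rewrite addr0 !mxE expr0 divr1 mul1r.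
  by rewrite mxE ad_rootX_lower ?mulr0.
rewrite unitmxE det_trig.
  by rewrite big1 ?unitr1 // => i _; rewrite expE ?eqxx.
apply/is_trig_mxP => i j lt_ij.
by rewrite expE ?(ltnW lt_ij) // -val_eqE ltn_eqF.
Qed.

Definition xroot (g : posroot) (t : F) : {'GL_14[F]} :=
  FinRing.unit _ (exp_ad_unit g t).
Definition Xroot (g : posroot) : {set {'GL_14[F]}} := [set xroot g t | t : F].

Definition P (A : {set posroot}) : {group {'GL_14[F]}} :=
  <<\bigcup_(g in A) Xroot g>>%G.
Definition UG2 : {group {'GL_14[F]}} := P setT.

End RootSubgroups.

Section Characters.
Variable F : finFieldType.
Implicit Type al : posroot.

(* X_al, generated by the set [Xroot F al] and hence equal to it, as a group. *)
Definition Xgrp al : {group {'GL_14[F]}} := P F [set al].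
Definition Sgrp al : {group {'GL_14[F]}} := P F (source al).
(* The kernel of S_al -> X_al. *)
Definition Xker al : {group {'GL_14[F]}} := P F (source al :\ al).
(* The kernel of S_al -> \overline{T}_al. *)
Definition Tker al : {group {'GL_14[F]}} := P F (al |: (leg al :|: kpattern al)).
Definition Tbar al : {group coset_of (Tker al)} := (Sgrp al / Tker al)%G.

Definition rs (i : Iirr (UG2 F)) : {set posroot} :=
  [set g | (Xroot F g \subset 'Z('chi_i)%CF)
           && ~~ (Xroot F g \subset cfker 'chi_i)].
Definition Irr_root al : {set Iirr (UG2 F)} := [set i | rs i == [set al]].
Definition Irr_mida al : {set Iirr (UG2 F)} :=
  [set i in Irr_root al |
    [forall j in Irr_root al, 'chi_i 1%g <= 'chi_j 1%g]].

(* The semidirect decomposition [defS] identifies X_al with the quotient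
   S_al / P(s(al) \ {al}); [cfSdprod defS] is inflation along S_al -> X_al. *)
Definition Psi al (defS : (Xker al ><| Xgrp al)%g = Sgrp al)
    (mu : Iirr (Tbar al)) (lam : Iirr (Xgrp al)) : 'CF(UG2 F) :=
  'Ind[UG2 F] (('chi_mu %% Tker al)%CF * cfSdprod defS 'chi_lam).

Definition midafis_are al (n d : nat) : Prop :=
  #|Irr_mida al| = n /\ forall i, i \in Irr_mida al -> 'chi_i 1%g = d%:R.

End Characters.

(* Main.v *)
(* Write U for UG2, K for P(k(alpha)), T for P({alpha} u l(alpha) u k(alpha)) and
   S for S_alpha.  A character chi of U has rs(chi) = {alpha} exactly when K lies in
   its kernel and X_alpha does not; X_alpha is central modulo K, so chi restricts to
   a multiple of some lambda <> 1 on X_alpha.  Commutators of an arm root subgroup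
   with a leg root subgroup sweep out X_alpha modulo K, so chi vanishes on T outside
   K X_alpha, and since arm and leg have the same size this gives
   <chi, lambda>_T = chi(1) / |U : S|.  As S/T is abelian, mu lambda is linear and
   restricts to lambda on T; the displayed multiplicity then forces the induced
   character to be irreducible, (mu, lambda) to be unique, and every such chi to be
   obtained.  All characters in Irr(UG2)_alpha thus have degree |U : S|.  The
   commutator relations are identities between integral polynomial matrices and are
   checked by computation. *)
Require Import Defs.
From mathcomp Require Import all_boot all_order all_algebra all_fingroup.
From mathcomp Require Import all_solvable all_field all_character.
Import Order.TTheory GRing.Theory Num.Theory.
Local Open Scope ring_scope.

Set Implicit Arguments.
Unset Strict Implicit.
Unset Printing Implicit Defensive.

(** * Integral polynomial matrices *)

(* Exponent vectors carry no trailing zero, so that equal monomials are equal as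
   sequences. *)
Definition mono := seq nat.
Definition ipoly := seq (int * mono).

Fixpoint mono_mul (m n : mono) : mono :=
  match m, n with
  | i :: m', j :: n' => (i + j)%N :: mono_mul m' n'
  | [::], _ => n
  | _, [::] => m
  end.
Definition ipoly_var (v : nat) : ipoly := [:: (1, rcons (nseq v 0%N) 1%N)].
Definition ipoly_const (c : int) : ipoly := if c == 0 then [::] else [:: (c, [::])].

Fixpoint ipoly_add1 (c : int) (m : mono) (p : ipoly) : ipoly :=
  if p is (d, n) :: p' then
    if m == n then if c + d == 0 then p' else (c + d, n) :: p'
    else (d, n) :: ipoly_add1 c m p'
  else [:: (c, m)].
Definition ipoly_add (p r : ipoly) : ipoly :=
  foldr (fun cm => ipoly_add1 cm.1 cm.2) r p.
Definition ipoly_scale (c : int) (p : ipoly) : ipoly :=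
  if c == 0 then [::] else [seq (c * cm.1, cm.2) | cm <- p].
Definition ipoly_mul (p r : ipoly) : ipoly :=
  foldr (fun cm => ipoly_add
           [seq (cm.1 * dn.1, mono_mul cm.2 dn.2) | dn <- r]) [::] p.
Fixpoint ipoly_exp (p : ipoly) (k : nat) : ipoly :=
  if k is k'.+1 then ipoly_mul p (ipoly_exp p k') else ipoly_const 1.
(** A sufficient test only: [ipoly_eval_eq] needs soundness, so the term lists need not be in normal
    form. *)
Definition ipoly_eq (p r : ipoly) : bool :=
  all (fun cm => cm.1 == 0) (ipoly_add p (ipoly_scale (-1) r)).
Definition ipoly_dvd (d : nat) (p : ipoly) : bool :=
  all (fun cm => (d %| cm.1)%Z) p.
Definition ipoly_div (d : nat) (p : ipoly) : ipoly :=
  [seq ((cm.1 %/ d)%Z, cm.2) | cm <- p].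

Definition ipmx := seq (seq ipoly).
Definition ent (M : ipmx) i j : ipoly := nth [::] (nth [::] M i) j.
Definition ipmx_of m n (f : nat -> nat -> ipoly) : ipmx :=
  mkseq (fun i => mkseq (f i) n) m.

Fixpoint row_add (r s : seq ipoly) : seq ipoly :=
  match r, s with
  | p :: r', t :: s' => ipoly_add p t :: row_add r' s'
  | [::], _ => s
  | _, [::] => r
  end.
(** Zero entries are skipped, which keeps products with the sparse matrices of ad e_g cheap. *)
Fixpoint row_mul (r : seq ipoly) (B : ipmx) : seq ipoly :=
  match r, B with
  | p :: r', b :: B' =>
      let s := row_mul r' B' in
      if p is [::] then s else row_add [seq ipoly_mul p t | t <- b] s
  | _, _ => [::]
  end.
Definition ipmx_mul (A B : ipmx) : ipmx := [seq row_mul r B | r <- A].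
Definition ipmx_eq m n (A B : ipmx) : bool :=
  all (fun i => all (fun j => ipoly_eq (ent A i j) (ent B i j)) (iota 0 n))
    (iota 0 m).

Section PolyEvaluation.
Variable R : comPzRingType.
Implicit Types (e : nat -> R) (p r : ipoly).

Fixpoint mono_eval e m : R :=
  if m is k :: m' then e 0%N ^+ k * mono_eval (e \o S) m' else 1.
Definition ipoly_eval e p : R := \sum_(cm <- p) cm.1%:~R * mono_eval e cm.2.
Definition ipmx_eval e m n (M : ipmx) : 'M[R]_(m, n) :=
  \matrix_(i, j) ipoly_eval e (ent M i j).

Lemma mono_eval_mul e m n :
  mono_eval e (mono_mul m n) = mono_eval e m * mono_eval e n.
Proof.
elim: m e n => [|i m IHm] e [|j n] //=; rewrite ?mul1r ?mulr1 //.
by rewrite IHm exprD mulrACA.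
Qed.

Lemma ipoly_eval0 e : ipoly_eval e [::] = 0.
Proof. exact: big_nil. Qed.

Lemma ipoly_eval_const e c : ipoly_eval e (ipoly_const c) = c%:~R.
Proof.
rewrite /ipoly_const; case: eqP => [->|_]; first exact: ipoly_eval0.
by rewrite /ipoly_eval big_seq1 mulr1.
Qed.

Lemma ipoly_eval_var e v : ipoly_eval e (ipoly_var v) = e v.
Proof.
rewrite /ipoly_eval big_seq1 mul1r /=.
by elim: v e => [|v IHv] e /=; rewrite ?mulr1 ?mul1r ?IHv.
Qed.

Lemma ipoly_eval_add1 e c m p :
  ipoly_eval e (ipoly_add1 c m p) = c%:~R * mono_eval e m + ipoly_eval e p.
Proof.
rewrite /ipoly_eval; elim: p => [|[d n] p IHp] /=.
  by rewrite big_seq1 big_nil addr0.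
case: eqP => [->|_]; last by rewrite !big_cons /= IHp addrCA.
case: eqP => [cd0|_]; rewrite !big_cons /= addrA -mulrDl -intrD //.
by rewrite cd0 mul0r add0r.
Qed.

Lemma ipoly_evalD e p r :
  ipoly_eval e (ipoly_add p r) = ipoly_eval e p + ipoly_eval e r.
Proof.
elim: p => [|[c m] p IHp] /=; first by rewrite ipoly_eval0 add0r.
by rewrite ipoly_eval_add1 IHp [ipoly_eval e (_ :: _)]big_cons addrA.
Qed.

Lemma ipoly_evalZ e c p : ipoly_eval e (ipoly_scale c p) = c%:~R * ipoly_eval e p.
Proof.
rewrite /ipoly_scale; case: eqP => [->|_]; first by rewrite ipoly_eval0 mul0r.
rewrite /ipoly_eval big_map big_distrr; apply: eq_bigr => cm _ /=.
by rewrite intrM mulrA.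
Qed.

Lemma ipoly_evalM e p r :
  ipoly_eval e (ipoly_mul p r) = ipoly_eval e p * ipoly_eval e r.
Proof.
elim: p => [|[c m] p IHp] /=; first by rewrite ipoly_eval0 mul0r.
rewrite ipoly_evalD IHp [ipoly_eval e (_ :: _)]big_cons mulrDl; congr (_ + _).
rewrite /ipoly_eval big_map big_distrr; apply: eq_bigr => dn _ /=.
by rewrite intrM mono_eval_mul mulrACA.
Qed.

Lemma ipoly_evalX e p k : ipoly_eval e (ipoly_exp p k) = ipoly_eval e p ^+ k.
Proof.
elim: k => [|k IHk] /=; first by rewrite ipoly_eval_const.
by rewrite ipoly_evalM IHk exprS.
Qed.

Lemma ipoly_eval_eq e p r : ipoly_eq p r -> ipoly_eval e p = ipoly_eval e r.
Proof.
move/allP=> eq0; apply/eqP; rewrite -subr_eq0 -mulN1r -[-1]/((-1)%:~R).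
rewrite -ipoly_evalZ -ipoly_evalD; apply/eqP; rewrite /ipoly_eval.
by rewrite big_seq big1 // => cm /eq0/eqP->; rewrite mul0r.
Qed.

(** Stated multiplicatively, since d need not be invertible in R. *)
Lemma ipoly_evalV e d p :
  ipoly_dvd d p -> d%:R * ipoly_eval e (ipoly_div d p) = ipoly_eval e p.
Proof.
move/allP=> dvd_d; rewrite /ipoly_eval big_map big_distrr big_seq [RHS]big_seq.
apply: eq_bigr => cm /dvd_d d_cm /=; rewrite mulrA; congr (_ * _).
by rewrite mulrC -[d%:R]/((d%:Z)%:~R) -intrM divzK.
Qed.

Lemma ent_of m n f i j :
  (i < m)%N -> (j < n)%N -> ent (ipmx_of m n f) i j = f i j.
Proof. by move=> lt_i lt_j; rewrite /ent !nth_mkseq. Qed.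

Lemma nth_row_add e (r s : seq ipoly) j :
  ipoly_eval e (nth [::] (row_add r s) j) =
  ipoly_eval e (nth [::] r j) + ipoly_eval e (nth [::] s j).
Proof.
elim: r s j => [|p r IHr] [|t s] [|j] //=; rewrite ?ipoly_eval0 ?addr0 ?add0r //.
exact: ipoly_evalD.
Qed.

Lemma nth_row_mul e (r : seq ipoly) B j :
  ipoly_eval e (nth [::] (row_mul r B) j) =
  \sum_(l < size r) ipoly_eval e (nth [::] r l) * ipoly_eval e (ent B l j).
Proof.
elim: r B => [|p r IHr] [|b B] /=; rewrite ?nth_nil ?big_ord0 ?ipoly_eval0 //.
  by rewrite big1 // => l _; rewrite /ent !nth_nil ipoly_eval0 mulr0.
rewrite big_ord_recl -IHr; case: p => [|cm p]; first by rewrite ipoly_eval0 mul0r add0r.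
rewrite nth_row_add; congr (_ + _); move: (cm :: p) => {cm p} p; rewrite /ent /=.
have [lt_j | le_j] := ltnP j (size b); first by rewrite (nth_map [::]) // ipoly_evalM.
by rewrite !nth_default ?size_map // ipoly_eval0 mulr0.
Qed.

(** The left factor has the form [ipmx_of m k f] so that its rows have length exactly k; entries
    missing from [B] read as zero. *)
Lemma ipmx_evalM e m k n f B :
  ipmx_eval e m n (ipmx_mul (ipmx_of m k f) B) =
  ipmx_eval e m k (ipmx_of m k f) *m ipmx_eval e k n B.
Proof.
apply/matrixP=> i j; rewrite !mxE /ent (nth_map [::]) ?size_mkseq // nth_row_mul.
rewrite nth_mkseq // size_mkseq.
by apply: eq_bigr => l _; rewrite !mxE ent_of // nth_mkseq.
Qed.

Lemma ipmx_eval_eq e m n A B :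
  ipmx_eq m n A B -> ipmx_eval e m n A = ipmx_eval e m n B.
Proof.
move=> /allP eqAB; apply/matrixP=> i j; rewrite !mxE; apply: ipoly_eval_eq.
have /allP := eqAB i ltac:(by rewrite mem_iota ltn_ord).
by apply; rewrite mem_iota ltn_ord.
Qed.

End PolyEvaluation.

(** * Divided powers of ad e_g and integral matrices of root elements *)

Definition ad_ipmx (g : posroot) : ipmx :=
  ipmx_of 14 14 (fun i j => ipoly_const
    (coef (nth H1 chev_basis i)
       (bracket (E (rcoord g)) (nth H1 chev_basis j)))).
Fixpoint ad_ipmx_exp g k : ipmx :=
  if k is k'.+1 then ipmx_mul (ad_ipmx g) (ad_ipmx_exp g k')
  else ipmx_of 14 14 (fun i j => ipoly_const (i == j)).

(* The divided powers (ad e_g)^k / k! of a Chevalley basis are integral. *)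
Definition divided_power g k : ipmx :=
  let M := ad_ipmx_exp g k in
  ipmx_of 14 14 (fun i j => ipoly_div k`! (ent M i j)).
(** Tabulated once, root by root because only closed terms evaluate, so that later checks do not
    recompute matrix powers. *)
Definition divided_powers (g : posroot) : seq ipmx :=
  Eval vm_compute in
  match g with
  | a1 => mkseq (divided_power a1) 4 | a2 => mkseq (divided_power a2) 4
  | a3 => mkseq (divided_power a3) 4 | a4 => mkseq (divided_power a4) 4
  | a5 => mkseq (divided_power a5) 4 | a6 => mkseq (divided_power a6) 4
  end.

Definition xroot_ipmx g (p : ipoly) : ipmx :=
  ipmx_of 14 14 (fun i j =>
    foldr (fun k => ipoly_add
       (ipoly_mul (ent (nth [::] (divided_powers g) k) i j) (ipoly_exp p k)))
      [::] (iota 0 4)).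

Lemma divided_powersE g : divided_powers g = mkseq (divided_power g) 4.
Proof. by case: g; vm_compute. Qed.

(** A finite check, which makes the integer division in [divided_power] exact. *)
Lemma ad_ipmx_exp_dvd g k i j :
  (k < 4)%N -> (i < 14)%N -> (j < 14)%N -> ipoly_dvd k`! (ent (ad_ipmx_exp g k) i j).
Proof.
move=> k4 i14 j14.
have : all (fun k => let M := ad_ipmx_exp g k in all (fun i => all (fun j =>
  ipoly_dvd k`! (ent M i j)) (iota 0 14)) (iota 0 14)) (iota 0 4).
  by case: g; vm_compute.
move/allP/(_ k); rewrite mem_iota => /(_ k4)/allP/(_ i); rewrite mem_iota.
by move=> /(_ i14)/allP/(_ j); rewrite mem_iota => /(_ j14).
Qed.

Section MatrixOfRootElement.
Variables (F : finFieldType) (e : nat -> F).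
(** The form in which characteristic > 3 enters: 2 and 3 are invertible in F. *)
Hypothesis fact_neq0 : forall k, (k < 4)%N -> (k`!)%:R != 0 :> F.

Lemma ad_ipmxE g : ipmx_eval e 14 14 (ad_ipmx g) = ad_root F g.
Proof. by apply/matrixP=> i j; rewrite !mxE ent_of // ipoly_eval_const. Qed.

Lemma ad_ipmx_expE g k : ipmx_eval e 14 14 (ad_ipmx_exp g k) = ad_root F g ^+ k.
Proof.
elim: k => [|k IHk]; last by rewrite exprS -IHk -ad_ipmxE; apply: ipmx_evalM.
by apply/matrixP=> i j; rewrite !mxE ent_of // ipoly_eval_const val_eqE; case: eqP.
Qed.

Lemma xroot_ipmxE g p :
  ipmx_eval e 14 14 (xroot_ipmx g p) = val (xroot g (ipoly_eval e p)).
Proof.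
apply/matrixP=> i j; rewrite mxE ent_of // [val _]/(exp_ad g _) summxE.
rewrite -(big_mkord xpredT (fun k => (((ipoly_eval e p) ^+ k / (k`!)%:R) *:
  ad_root F g ^+ k) i j)) /index_iota subn0 divided_powersE.
(* The induction runs over an arbitrary list of exponents, so the bound k < 4 is carried along. *)
have : all (fun k => (k < 4)%N) (iota 0 4) by [].
elim: (iota 0 4) => [|k s IHs] /=; first by rewrite ipoly_eval0 big_nil.
case/andP=> k4 /IHs {}IHs; rewrite big_cons ipoly_evalD ipoly_evalM ipoly_evalX IHs.
congr (_ + _); rewrite mulrC mxE -mulrA; congr (_ * _).
apply: (canRL (mulKf (fact_neq0 k4))); rewrite nth_mkseq // ent_of //.
by rewrite ipoly_evalV ?ad_ipmx_exp_dvd // -ad_ipmx_expE mxE.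
Qed.

Lemma xroot_ipmx_mulE g p n B :
  ipmx_eval e 14 n (ipmx_mul (xroot_ipmx g p) B) =
  val (xroot g (ipoly_eval e p)) *m ipmx_eval e 14 n B.
Proof. by rewrite -xroot_ipmxE -ipmx_evalM. Qed.

End MatrixOfRootElement.

(** * Commutator relations and normal form *)

(* [(c, (i, j))] stands for c t^i u^j in the coordinate at [g] of the commutator
   of x_a(t) and x_b(u). *)
Definition comm_monomial (a b g : posroot) : int * (nat * nat) :=
  match a, b, g with
  | a1, a2, a3 => (1, (1, 1)%N) | a1, a2, a4 => (-1, (2, 1)%N)
  | a1, a2, a5 => (1, (3, 1)%N) | a1, a2, a6 => (-2, (3, 2)%N)
  | a2, a1, a3 => (-1, (1, 1)%N) | a2, a1, a4 => (1, (1, 2)%N)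
  | a2, a1, a5 => (-1, (1, 3)%N) | a2, a1, a6 => (-1, (2, 3)%N)
  | a1, a3, a4 => (2, (1, 1)%N) | a1, a3, a5 => (-3, (2, 1)%N)
  | a1, a3, a6 => (3, (1, 2)%N)
  | a3, a1, a4 => (-2, (1, 1)%N) | a3, a1, a5 => (3, (1, 2)%N)
  | a3, a1, a6 => (-3, (2, 1)%N)
  | a1, a4, a5 => (3, (1, 1)%N) | a4, a1, a5 => (-3, (1, 1)%N)
  | a2, a5, a6 => (1, (1, 1)%N) | a5, a2, a6 => (-1, (1, 1)%N)
  | a3, a4, a6 => (-3, (1, 1)%N) | a4, a3, a6 => (3, (1, 1)%N)
  | _, _, _ => (0, (0, 0)%N)
  end.

Section RootRelations.
Variables (gT : finGroupType) (F : finFieldType) (x : posroot -> F -> gT).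

Definition comm_coord a b g (t u : F) : F :=
  let: (c, (i, j)) := comm_monomial a b g in c%:~R * (t ^+ i * u ^+ j).

Definition elt (t : posroot -> F) : gT :=
  (x a1 (t a1) * x a2 (t a2) * x a3 (t a3) * x a4 (t a4) * x a5 (t a5)
   * x a6 (t a6))%g.

(** The interface between the matrix computations and the group theory: additivity in each root
    subgroup, the Chevalley commutator formula, and uniqueness of the normal form. No commutator has
    a component at the simple roots [a1] and [a2]. *)
Record root_relations : Prop := RootRelations {
  rootD : forall g s t, (x g s * x g t)%g = x g (s + t);
  root_comm : forall a b t u, [~ x a t, x b u]%g =
    (x a3 (comm_coord a b a3 t u) * x a4 (comm_coord a b a4 t u)
     * x a5 (comm_coord a b a5 t u) * x a6 (comm_coord a b a6 t u))%g;
  elt_inj : forall t s, elt t = elt s -> t =1 s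
}.

End RootRelations.

Section RootGroupRelations.
Variables (F : finFieldType).
Hypothesis fact_neq0 : forall k, (k < 4)%N -> (k`!)%:R != 0 :> F.

Local Notation x := (@xroot F).
Local Notation M p e := (ipmx_eval e 14 14 p).

(** With s and t as values of two variables, this becomes one integral polynomial matrix identity
    for each root. *)
Lemma xrootD g s t : (x g s * x g t)%g = x g (s + t).
Proof.
pose e i := nth 0 [:: s; t] i.
have es : s = ipoly_eval e (ipoly_var 0) by rewrite ipoly_eval_var.
have et : t = ipoly_eval e (ipoly_var 1) by rewrite ipoly_eval_var.
apply: val_inj; rewrite es et -ipoly_evalD FinRing.val_unitM.
rewrite -[RHS]xroot_ipmxE // -[val (x g (ipoly_eval e (ipoly_var 1)))]xroot_ipmxE //.
rewrite -[LHS]xroot_ipmx_mulE //.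
by apply: ipmx_eval_eq; case: g; vm_compute.
Qed.

Lemma xroot_comm a b t u :
  [~ x a t, x b u]%g =
  (x a3 (comm_coord a b a3 t u) * x a4 (comm_coord a b a4 t u)
   * x a5 (comm_coord a b a5 t u) * x a6 (comm_coord a b a6 t u))%g.
Proof.
pose e i := nth 0 [:: t; u] i.
pose p := ipoly_var 0; pose r := ipoly_var 1.
have et : t = ipoly_eval e p by rewrite ipoly_eval_var.
have eu : u = ipoly_eval e r by rewrite ipoly_eval_var.
pose c g := let: (c, (i, j)) := comm_monomial a b g in
  ipoly_scale c (ipoly_mul (ipoly_exp p i) (ipoly_exp r j)).
have ec g : comm_coord a b g t u = ipoly_eval e (c g).
  rewrite /comm_coord /c; case: (comm_monomial a b g) => k [i j].
  by rewrite ipoly_evalZ ipoly_evalM !ipoly_evalX -et -eu.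
(* Rewriting as x_a x_b = x_b x_a [x_a, x_b] removes the inverses, so that both sides are polynomial
   matrices. *)
apply: (mulgI (x b u * x a t)%g); rewrite -commgC !ec !mulgA.
rewrite [in LHS]et [in LHS]eu [in X in (x b X * _)%g]eu [in X in (_ * x a X)%g]et.
rewrite -!mulgA; apply: val_inj; rewrite !FinRing.val_unitM.
rewrite -[val (x a6 _)]xroot_ipmxE // -[X in _ * X = _]xroot_ipmxE //.
have mulE g s B : val (x g (ipoly_eval e s)) * (M B e : 'M_13.+1)
    = M (ipmx_mul (xroot_ipmx g s) B) e by rewrite xroot_ipmx_mulE.
rewrite !mulE.
by apply: ipmx_eval_eq; rewrite /c /p /r; clear -a b; case: a; case: b; vm_compute.
Qed.

Definition posroots := [:: a1; a2; a3; a4; a5; a6].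

(* The images of h_1 and h_2, the basis vectors of index 6 and 7, under
   x_{a1}(t1) ... x_{a6}(t6), where the variable of index i is t(i+1). *)
Definition coroot_columns : ipmx :=
  ipmx_of 14 2 (fun i j => ipoly_const (i == j + 6)%N).
Definition elt_columns : ipmx :=
  let X g v := ipmx_mul (xroot_ipmx g (ipoly_var v)) in
  X a1 0 (X a2 1 (X a3 2 (X a4 3 (X a5 4 (X a6 5 coroot_columns))))).

(** Only variables of index at most 5 occur, so the default [a1] of [nth] is harmless. *)
Lemma elt_columnsE t (e := fun i => t (nth a1 posroots i)) :
  ipmx_eval e 14 2 elt_columns
    = val (elt x t) *m \matrix_(i < 14, j < 2) (val i == j + 6)%N%:R.
Proof.
have mulA (A B : 'M[F]_13.+1) (C : 'M_(14, 2)) : (A * B) *m C = A *m (B *m C).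
  by rewrite mulmxA.
rewrite /elt !FinRing.val_unitM !mulA /elt_columns.
rewrite !(xroot_ipmx_mulE _ fact_neq0) !ipoly_eval_var.
do 6 congr (_ *m _); apply/matrixP=> i j.
by rewrite !mxE ent_of // ipoly_eval_const; case: eqP.
Qed.

(** An exponent vector of length at most k involves only the variables of index below k. *)
Definition ipoly_below k (p : ipoly) : bool :=
  all (fun cm => size cm.2 <= k)%N p.

Lemma ipoly_below_eval k p (e f : nat -> F) :
  ipoly_below k p -> (forall i, (i < k)%N -> e i = f i) ->
  ipoly_eval e p = ipoly_eval f p.
Proof.
move=> /allP below ef; rewrite /ipoly_eval big_seq [RHS]big_seq.
apply: eq_bigr => cm /below; move: cm.2 => m le_m; congr (_ * _).
elim: m k e f le_m ef {below} => [|l m IHm] [|k] //= e f le_m ef.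
by rewrite ef // (IHm k _ (f \o S)) // => i lt_i; apply: ef.
Qed.

(** The images of the two coroots determine the coordinates one after the other: for each k, some
    entry is linear in the variable k with invertible coefficient, up to a polynomial in the earlier
    variables. *)
Lemma xroot_elt_inj t s : elt x t = elt x s -> t =1 s.
Proof.
move=> eq_ts.
have eE := elt_columnsE t; have fE := elt_columnsE s.
set e := fun i => t _ in eE; set f := fun i => s _ in fE.
suff ef : forall k, (k <= 6)%N -> forall i, (i < k)%N -> e i = f i.
  by case; [move: (ef 6%N isT 0%N isT) | move: (ef 6%N isT 1%N isT)
   | move: (ef 6%N isT 2%N isT) | move: (ef 6%N isT 3%N isT)
   | move: (ef 6%N isT 4%N isT) | move: (ef 6%N isT 5%N isT)].
elim=> // k IHk k6 i; rewrite ltnS leq_eqVlt => /predU1P[-> | ]; last first.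
  by apply: IHk; exact: ltnW.
(* Row 8 + k is the coordinate at the root vector of index k, and c is the pairing of that root with
   the coroot of the chosen column, since [e_r, h] = - <r, h> e_r. The last root pairs to 0 with the
   first coroot, hence column 1 there. *)
have [j [l [c [j14 l2 c0 below]]]] : exists j l c,
  [/\ (j < 14)%N, (l < 2)%N, c%:~R != 0 :> F & ipoly_below k
     (ipoly_add (ent elt_columns j l) (ipoly_scale c (ipoly_var k)))].
  have F1 : (1%:Z)%:~R != 0 :> F by rewrite oner_eq0.
  have F2 : (2%:Z)%:~R != 0 :> F by apply: (fact_neq0 (k := 2)).
  have F3 : (3%:Z)%:~R != 0 :> F.
    have := fact_neq0 (isT : 3 < 4)%N.
    by rewrite (natrM _ 3 2) mulf_eq0 negb_or => /andP[].
  have Fn c : c%:~R != 0 :> F -> (- c)%:~R != 0 :> F by rewrite intrN oppr_eq0.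
  case: k k6 {IHk} => [|[|[|[|[|[|//]]]]]] _.
  - by exists 8%N, 0%N, 2; split; [| | exact: F2 | vm_compute].
  - by exists 9%N, 0%N, (-3); split; [| | exact: Fn F3 | vm_compute].
  - by exists 10%N, 0%N, (-1); split; [| | exact: Fn F1 | vm_compute].
  - by exists 11%N, 0%N, 1; split; [| | exact: F1 | vm_compute].
  - by exists 12%N, 0%N, 3; split; [| | exact: F3 | vm_compute].
  - by exists 13%N, 1%N, 1; split; [| | exact: F1 | vm_compute].
have := ipoly_below_eval below (IHk (ltnW k6)).
rewrite !ipoly_evalD !ipoly_evalZ !ipoly_eval_var.
have -> : ipoly_eval e (ent elt_columns j l) = ipoly_eval f (ent elt_columns j l).
  have : ipmx_eval e 14 2 elt_columns = ipmx_eval f 14 2 elt_columns.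
    by rewrite eE fE eq_ts.
  by move/matrixP/(_ (Ordinal j14) (Ordinal l2)); rewrite !mxE.
by move/addrI/(mulfI c0).
Qed.

Lemma xroot_relations : root_relations x.
Proof. exact: RootRelations xrootD xroot_comm xroot_elt_inj. Qed.

End RootGroupRelations.

(** * Patterns of positive roots *)

(** Boolean predicates instead of [{set posroot}], so that closure conditions are decided by
    computation. *)
Definition pattern := posroot -> bool.
Definition pall (p : pattern) := all p posroots.
Lemma pallP (p : pattern) : reflect (forall g, p g) (pall p).
Proof.
apply: (iffP allP) => [allp g | allp g _]; last exact: allp.
by apply: allp; case: g; rewrite !inE eqxx ?orbT.
Qed.

Definition psub (p r : pattern) := pall (fun g => p g ==> r g).
Definition commin a b (d : pattern) :=
  pall (fun g => ((comm_monomial a b g).1 != 0) ==> d g).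
Definition pcomm (p r d : pattern) :=
  pall (fun a => pall (fun b => (p a && r b) ==> commin a b d)).
(** The combinatorial condition for P(p) to be normal in P(r); [pnormal p p] says that p is closed
    under commutators. *)
Definition pnormal (p r : pattern) := psub p r && pcomm p r p.

Definition pidx g :=
  match g with a1 => 0 | a2 => 1 | a3 => 2 | a4 => 3 | a5 => 4 | a6 => 5 end%N.
Definition pfrom k (g : posroot) : bool := (k <= pidx g)%N.

(* Equality on posroot is defined through inord and does not compute. *)
Definition peq (g h : posroot) : bool := rcoord g == rcoord h.
Lemma peqE g h : peq g h = (g == h).
Proof. by apply/eqP/eqP=> [|-> //]; case: g; case: h. Qed.

Definition allp : pattern := fun _ => true.
Definition armp al : pattern := fun g =>
  match al with
  | a1 | a2 => false
  | a3 | a4 | a5 => peq g a1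
  | a6 => peq g a2 || peq g a3
  end.
Definition legp al : pattern := fun g =>
  [&& has (fun d => rsum g d al) posroots, ~~ peq g al & ~~ armp al g].
Definition kp al : pattern := fun g =>
  match al with a1 | a2 => ~~ peq g al | _ => pfrom (pidx al).+1 g end.
Definition sourcep al : pattern := fun g => ~~ armp al g.
Definition centerp al : pattern := fun g => kp al g || peq g al.
Definition tkerp al : pattern := fun g => [|| peq g al, legp al g | kp al g].
Definition xkerp al : pattern := fun g => sourcep al g && ~~ peq g al.

Lemma kpatternE al : kpattern al = [set g | kp al g].
Proof.
apply/eqP; rewrite eqEsubset andbC; apply/andP; split.
  apply: kpattern_max; last by rewrite inE /kp; case: al.
  apply/forall_inP=> b; rewrite inE => kb; apply/forallP=> c; apply/forallP=> d.
  apply/implyP=> bcd; rewrite inE; move: kb bcd.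
  by case: al; case: b => //; case: c => //; case: d.
(* From any root outside [kp al] other than [al], adding a positive root leads to a later root still
   outside [kp al]. Descending induction then ends at [al], which no set N admits. *)
have : pall (fun al => pall (fun g => [|| kp al g, peq g al | has (fun c =>
  has (fun d => [&& rsum g c d, ~~ kp al d & (pidx g < pidx d)%N]) posroots)
  posroots])) by vm_compute.
move/pallP/(_ al)/pallP=> up.
suff kn n g : (6 - pidx g <= n)%N -> ~~ kp al g -> g \notin kpattern al.
  by apply/subsetP=> g; rewrite inE; apply: contraTT; apply: kn (leqnn _).
elim: n g => [|n IHn] g le_n kg; first by move: le_n; case: (g).
have := up g; rewrite (negPf kg) orFb peqE => /predU1P[-> | ].
  exact: kpattern_notin.
case/hasP=> c _ /hasP[d _ /and3P[gcd kd lt_gd]]; apply: contra (IHn d _ kd).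
  move=> kg'; have /forall_inP/(_ g kg')/forallP/(_ c)/forallP/(_ d) := kpattern_normal al.
  by rewrite gcd.
by rewrite -ltnS (leq_trans _ le_n) // ltn_sub2l //; case: (g).
Qed.

Lemma armE al : arm al = [set g | armp al g].
Proof. by apply/setP=> g; case: al; rewrite !inE //= !peqE. Qed.

Lemma legE al : leg al = [set g | legp al g].
Proof.
apply/setP=> g; rewrite !inE armE inE /legp peqE.
have [_ | _] := eqVneq g al; first by rewrite /= andbF.
rewrite orFb andTb andbC; congr (_ && _).
apply/existsP/idP=> [[d gd] | /hasP[d _ gd]]; last by exists d.
by apply/hasP; exists d => //; case: (d); rewrite !inE !eqxx ?orbT.
Qed.

(* [x_b(t), x_c(u)] = x_g(k t u) modulo the root subgroups in [d], where k <> 0. *)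
Definition linked (b c g : posroot) (d : pattern) : bool :=
  let: (k, (i, j)) := comm_monomial b c g in
  [&& (`|k|%N \in [:: 1; 2; 3]%N), (i == 1)%N, (j == 1)%N &
      pall (fun h => [|| (comm_monomial b c h).1 == 0, peq h g | d h && (pidx g < pidx h)%N])].

(** * Characters induced from the source of a root *)

Section CentralElements.
Variables (gT : finGroupType) (G : {group gT}).
Implicit Type i : Iirr G.

(** Z(chi) / ker(chi) is the centre of G / ker(chi). *)
Lemma sub_cfcenter_irr i (B : {group gT}) : B \subset G ->
  (B \subset 'Z('chi_i)%CF) = ([~: G, B]%g \subset cfker 'chi_i).
Proof.
move=> sBG; have nG := cfker_norm 'chi_i; have nB := subset_trans sBG nG.
rewrite -(quotientSGK nB (normal_sub (cfker_center_normal _))).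
rewrite cfcenter_eq_center subsetI quotientS //=.
by rewrite quotient_cents2 // commGC.
Qed.

(** An element of Z(chi) acts as the scalar chi(a) / chi(1). *)
Lemma irr_cfcenterM i y a : a \in 'Z('chi_i)%CF -> y \in G ->
  'chi_i (y * a)%g = 'chi_i y * ('chi_i a / 'chi_i 1%g).
Proof.
move=> Za Gy; have := irr1_neq0 i; move: Za.
rewrite -irrRepr cfcenter_repr => /setIdP[Ga /is_scalar_mxP[c ac]].
rewrite !cfunE group1 groupM // Ga Gy !mulr1n repr_mx1 repr_mxM // ac.
rewrite mul_mx_scalar !mxtraceZ mxtrace_scalar mxtrace1 mulrC => n0.
by rewrite -[c *+ _]mulr_natr mulfK.
Qed.

Lemma cfcenter_irr_neq0 i z : z \in 'Z('chi_i)%CF -> 'chi_i z != 0.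
Proof.
move=> Zz; have Gz : z \in G by apply: subsetP Zz; apply: cfcenter_sub.
move: Zz; rewrite irr_cfcenterE // -normr_eq0 => /eqP->; exact: irr1_neq0.
Qed.

(** The remaining summand is a character of degree at most 0, hence zero. *)
Lemma irr_constt_eq i chi : chi \is a character -> i \in irr_constt chi ->
  chi 1%g <= 'chi_i 1%g -> chi = 'chi_i.
Proof.
move=> Nchi /(constt_charP _ Nchi)[psi Npsi ->]; rewrite cfunE gerDl => psi1_le0.
suff -> : psi = 0 by rewrite addr0.
by apply/eqP; rewrite -char1_eq0 // eq_le psi1_le0 char1_ge0.
Qed.

End CentralElements.

(* U, S, T, K, X, N stand for UG2, S_alpha, the kernel of S_alpha -> \bar T_alpha,
   P(k(alpha)), X_alpha and the kernel of S_alpha -> X_alpha.  [card_leg] says that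
   arm and leg have the same size; [vanT] that, modulo K, the commutators of an
   element of T outside K X with U sweep out X. *)
Section ArmLeg.
Variables (gT : finGroupType) (U S T K X N : {group gT}).
Hypotheses (sSU : S \subset U) (nTS : (T <| S)%g) (sXT : X \subset T).
Hypotheses (sKT : K \subset T) (nKU : (K <| U)%g) (cXU : [~: U, X]%g \subset K).
Hypotheses (abX : abelian X) (abST : [~: S, S]%g \subset T).
Hypotheses (defS : (N ><| X)%g = S) (sKN : K \subset N).
Hypothesis card_leg : (#|U : S|%g * #|(K <*> X)%g| = #|T|)%N.
Hypothesis vanT : forall y, y \in T -> y \notin (K <*> X)%g ->
  exists2 z, z \in (K <*> X)%g & forall a, a \in X ->
  exists2 x, x \in U & exists2 k, k \in K & ((y * z) ^ x = y * z * a * k)%g.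

Definition arm_irr : {set Iirr U} :=
  [set i | (K \subset cfker 'chi_i) && ~~ (X \subset cfker 'chi_i)].
Definition arm_Psi (mu : Iirr (S / T)) (lam : Iirr X) : 'CF(U) :=
  'Ind[U, S] (('chi_mu %% T)%CF * cfSdprod defS 'chi_lam).

Let sTS : T \subset S. Proof. exact: normal_sub. Qed.
Let sTU : T \subset U. Proof. exact: subset_trans sTS sSU. Qed.
Let sXU : X \subset U. Proof. exact: subset_trans sXT sTU. Qed.
Let sXS : X \subset S. Proof. exact: subset_trans sXT sTS. Qed.

Lemma KX_mul : (K <*> X = K * X)%g.
Proof. by rewrite norm_joinEr // (subset_trans sXU) // normal_norm. Qed.

Lemma arm_sub_center i : K \subset cfker 'chi[U]_i -> (K <*> X)%g \subset 'Z('chi_i)%CF.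
Proof.
move=> kerK; rewrite join_subG.
rewrite (subset_trans kerK (normal_sub (cfker_center_normal _))) /=.
by rewrite sub_cfcenter_irr // (subset_trans cXU).
Qed.

(** Choose a in X acting by a scalar other than 1. Conjugation turns yz into yzak, so chi(yz) equals
    its product with that scalar and vanishes; since z acts as a nonzero scalar, chi(y) vanishes
    too. *)
Lemma arm_van i y : i \in arm_irr -> y \in T -> y \notin (K <*> X)%g -> 'chi_i y = 0.
Proof.
rewrite inE => /andP[kerK /subsetPn[a Xa a_ker]] Ty KXy.
have /subsetP sKXZ := arm_sub_center kerK; have Uy := subsetP sTU y Ty.
have sX : {subset X <= (K <*> X)%g} by apply/subsetP/joing_subr.
have [z KXz /(_ a Xa)[x Ux [k Kk conj_yz]]] := vanT Ty KXy.
have Uz : z \in U by apply: subsetP (sKXZ z KXz); apply: cfcenter_sub.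
have : 'chi_i (y * z)%g = 0.
  have /eqP : 'chi_i ((y * z) ^ x)%g = 'chi_i (y * z)%g by rewrite cfunJ.
  rewrite conj_yz cfkerMr ?(subsetP kerK) // irr_cfcenterM ?groupM ?sKXZ ?sX //.
  rewrite -subr_eq0 -[X in _ - X]mulr1 -mulrBr mulf_eq0 => /orP[/eqP // | ].
  rewrite subr_eq0 => /eqP a1; case/negP: a_ker; rewrite cfkerEirr inE.
  by rewrite -(divfK (irr1_neq0 i) ('chi_i a)) a1 mul1r.
rewrite irr_cfcenterM ?sKXZ // => /eqP; rewrite mulf_eq0 => /orP[/eqP // | ].
rewrite mulf_eq0 invr_eq0 (negPf (irr1_neq0 i)) orbF.
by rewrite (negPf (cfcenter_irr_neq0 _)) // sKXZ.
Qed.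

Lemma indexUS_neq0 : #|U : S|%g%:R != 0 :> algC.
Proof. by rewrite pnatr_eq0 -lt0n indexg_gt0. Qed.

(** Only K X contributes to the sum over T, and there each term is chi(1); [card_leg] then evaluates
    |K X| / |T|. *)
Lemma arm_cfdot i (L : 'CF(S)) : i \in arm_irr -> L \is a linear_char ->
  K \subset cfker L -> {in X, forall a, 'chi_i a = 'chi_i 1%g * L a} ->
  '['Res[T] 'chi_i, 'Res[T] L] = 'chi_i 1%g / #|U : S|%g%:R.
Proof.
move=> Ai linL kerL eqX; have /setIdP[kerK _] := Ai.
have sKX : (K <*> X)%g \subset T by rewrite join_subG sKT.
rewrite cfdotE (big_setID (K <*> X)%g) /= (setIidPr sKX).
rewrite [X in _ + X]big1 ?addr0 => [|y /setDP[Ty KXy]]; last first.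
  by rewrite cfResE ?arm_van ?mul0r.
rewrite (eq_bigr (fun _ => 'chi_i 1%g)) => [|y KXy]; last first.
  have Ty := subsetP sKX y KXy; rewrite !cfResE //.
  move: KXy Ty; rewrite KX_mul => /mulsgP[k a Kk Xa ->] _.
  rewrite !cfkerMl ?(subsetP kerK) ?(subsetP kerL) // eqX //.
  by rewrite -mulrA -normCK normC_lin_char ?(subsetP sXS) // expr1n mulr1.
rewrite sumr_const -card_leg natrM -['chi_i 1%g *+ _]mulr_natr mulrC invfM.
by rewrite mulrACA divff ?mulr1 // pnatr_eq0 -lt0n cardG_gt0.
Qed.

Let theta mu lam : 'CF(S) := ('chi[S / T]_mu %% T)%CF * cfSdprod defS 'chi_lam.

Lemma lam_lin lam : cfSdprod defS 'chi_lam \is a linear_char.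
Proof. by rewrite cfSdprod_lin_char; move/char_abelianP: abX. Qed.

Lemma ab_quo : abelian (S / T).
Proof. by rewrite sub_der1_abelian. Qed.

Lemma mu_lin mu : ('chi[S / T]_mu %% T)%CF \is a linear_char.
Proof. by rewrite cfMod_lin_charE //; move/char_abelianP: ab_quo. Qed.

Lemma theta_lin mu lam : theta mu lam \is a linear_char.
Proof. by rewrite rpredM ?lam_lin ?mu_lin. Qed.

Lemma theta_Res mu lam : 'Res[T] (theta mu lam) = 'Res[T] (cfSdprod defS 'chi_lam).
Proof.
apply/cfun_inP=> y Ty; rewrite !cfResE // cfunE.
by rewrite cfker1 ?lin_char1 ?mu_lin ?mul1r // (subsetP (cfker_mod _ _)).
Qed.

Lemma theta_ker mu lam : K \subset cfker (theta mu lam).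
Proof.
apply: subset_trans (cfker_mul _ _); rewrite subsetI.
rewrite (subset_trans sKT) ?cfker_mod //=.
exact: subset_trans sKN (cfker_sdprod _ _).
Qed.

Lemma thetaX mu lam : {in X, theta mu lam =1 'chi_lam}.
Proof.
move=> a Xa; rewrite /= cfunE cfSdprodEr // cfker1 ?lin_char1 ?mu_lin ?mul1r //.
by rewrite (subsetP (cfker_mod _ _)) // (subsetP sXT).
Qed.

Lemma theta_inj mu mu' lam lam' :
  theta mu lam = theta mu' lam' -> mu = mu' /\ lam = lam'.
Proof.
move=> eq_th; have eq_lam : lam = lam'.
  apply: irr_inj; apply/cfun_inP=> a Xa.
  by rewrite -(thetaX mu) // eq_th thetaX.
split=> //; move: eq_th; rewrite eq_lam => /(mulIr (lin_char_unitr (lam_lin lam'))).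
by rewrite -!mod_IirrE // => /irr_inj/(can_inj (mod_IirrK nTS)).
Qed.

Lemma Psi_char mu lam : arm_Psi mu lam \is a character.
Proof. by rewrite cfInd_char ?lin_charW ?theta_lin. Qed.

Lemma Psi1 mu lam : arm_Psi mu lam 1%g = #|U : S|%g%:R.
Proof. by rewrite cfInd1 // (lin_char1 (theta_lin mu lam)) mulr1. Qed.

(** K is normal in U and lies in the kernel of theta, hence in that of the induced character. X then
    acts by scalars, and Frobenius reciprocity identifies its central character as lambda. The index
    0 is the trivial character, so [lam != 0] keeps X out of the kernel. *)
Lemma arm_constt mu lam i : lam != 0 -> i \in irr_constt (arm_Psi mu lam) ->
  i \in arm_irr /\ {in X, forall a, 'chi_i a = 'chi_i 1%g * 'chi_lam a}.
Proof.
move=> lam0 ci; have := ci; rewrite irr_consttE cfdotC conjC_eq0 -cfdot_Res_l => nz.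
have [t defth] : exists t, theta mu lam = 'chi_t.
  by have /irrP := lin_char_irr (theta_lin mu lam).
have kerK : K \subset cfker 'chi_i.
  apply: subset_trans (cfker_constt (Psi_char mu lam) ci).
  rewrite /arm_Psi -/(theta _ _) defth cfker_Ind_irr // -defth.
  by rewrite sub_gcore ?theta_ker // normal_norm.
have sXZ : X \subset 'Z('chi_i)%CF.
  by apply: subset_trans (arm_sub_center kerK); rewrite joing_subr.
have eqX : {in X, forall a, 'chi_i a = 'chi_i 1%g * 'chi_lam a}.
  have [xi linxi resZ] := cfcenter_Res 'chi_i.
  have xiX a : a \in X -> 'chi_i a = 'chi_i 1%g * xi a.
    move=> Xa; rewrite -(cfResE _ (cfcenter_sub _) (subsetP sXZ a Xa)) resZ.
    by rewrite cfunE.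
  have constt_t : t \in irr_constt ('Res[S] 'chi_i) by rewrite irr_consttE -defth.
  have resX : 'Res[X] 'chi_i = 'chi_i 1%g *: 'Res[X] xi.
    apply/cfun_inP=> a Xa; by rewrite cfunE (cfResE _ sXU Xa) (cfResE xi sXZ Xa) xiX.
  have [s defs] : exists s, 'Res[X] xi = 'chi[X]_s.
    by have /irrP := lin_char_irr (cfRes_lin_char X linxi).
  have [r deft] : exists r, 'Res[X] 'chi_t = 'chi[X]_r.
    apply/irrP; rewrite -defth lin_char_irr // cfRes_lin_char ?theta_lin //.
  have rlam : r = lam.
    by apply: irr_inj; apply/cfun_inP=> a Xa; rewrite -deft cfResE // -defth thetaX.
  have : lam \in irr_constt ('Res[X] ('Res[S] 'chi_i)).
    apply: (constt_Res_trans _ constt_t); first by rewrite cfRes_char ?irr_char.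
    by rewrite deft rlam irr_consttE cfnorm_irr oner_eq0.
  rewrite cfResRes // irr_consttE resX defs cfdotZl cfdot_irr.
  case: (s =P lam) => [<- _|_]; last by rewrite mulr0 eqxx.
  by move=> a Xa; rewrite xiX // -defs (cfResE xi sXZ Xa).
split=> //; rewrite inE kerK; apply: contra lam0 => /subsetP kerX.
apply/eqP/irr_inj/cfun_inP=> a Xa; rewrite irr0 cfun1E Xa.
apply: (mulfI (irr1_neq0 i)); rewrite -eqX // mulr1.
by apply: cfker1; apply: kerX.
Qed.

Lemma arm_cfdot_theta mu lam i : lam != 0 -> i \in irr_constt (arm_Psi mu lam) ->
  '['Res[T] 'chi_i, 'Res[T] (theta mu lam)] = 'chi_i 1%g / #|U : S|%g%:R.
Proof.
move=> lam0 /(arm_constt lam0)[Ai eqX].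
apply: arm_cfdot => //; rewrite ?theta_lin ?theta_ker //.
by move=> a Xa; rewrite eqX // thetaX.
Qed.

(** The multiplicity chi(1) / |U : S| is a nonzero natural number, so chi(1) is at least |U : S|,
    the degree of the induced character. *)
Lemma Psi_constt mu lam i : lam != 0 -> i \in irr_constt (arm_Psi mu lam) ->
  arm_Psi mu lam = 'chi_i.
Proof.
move=> lam0 ci; apply: irr_constt_eq => //; first exact: Psi_char.
have [Ai _] := arm_constt lam0 ci; have eqd := arm_cfdot_theta lam0 ci.
have /natrP[n defn] : '['Res[T] 'chi_i, 'Res[T] (theta mu lam)] \in Num.nat.
  by rewrite Cnat_cfdot_char ?cfRes_char ?irr_char ?lin_charW ?theta_lin.
have : 'chi_i 1%g = n%:R * #|U : S|%g%:R by rewrite -defn eqd divfK ?indexUS_neq0.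
rewrite Psi1 => chi1; rewrite chi1 ler_peMl ?ler0n //.
rewrite ler1n lt0n; apply/eqP=> n0; move: chi1; rewrite n0 mul0r.
by move/eqP; rewrite (negPf (irr1_neq0 i)).
Qed.

Lemma arm_Psi_irr mu lam : lam != 0 -> exists2 i, i \in arm_irr & arm_Psi mu lam = 'chi_i.
Proof.
move=> lam0; have [i ci] : exists i, i \in irr_constt (arm_Psi mu lam).
  apply: neq0_has_constt; rewrite -char1_eq0 ?Psi_char // Psi1.
  exact: indexUS_neq0.
by exists i; [case: (arm_constt lam0 ci) | apply: Psi_constt].
Qed.

(** The central character on X gives lambda. Two different mu would give two distinct constituents
    of chi on S with the same restriction to T, and so multiplicity at least 2 where it is 1. *)
Lemma arm_Psi_inj mu mu' lam lam' : lam != 0 -> lam' != 0 ->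
  arm_Psi mu lam = arm_Psi mu' lam' -> mu = mu' /\ lam = lam'.
Proof.
move=> lam0 lam'0 eqPsi; have [i Ai defi] := arm_Psi_irr mu lam0.
have ci : i \in irr_constt (arm_Psi mu lam) by rewrite defi constt_irr !inE.
have ci' : i \in irr_constt (arm_Psi mu' lam') by rewrite -eqPsi.
have eq_lam : lam = lam'.
  have [[_ e1] [_ e2]] := (arm_constt lam0 ci, arm_constt lam'0 ci').
  apply: irr_inj; apply/cfun_inP=> a Xa; apply: (mulfI (irr1_neq0 i)).
  by rewrite -e1 // e2.
split=> //; subst lam'; apply/eqP; apply: wlog_neg => neq_mu.
have /irrP[t deft] := lin_char_irr (theta_lin mu lam).
have /irrP[t' deft'] := lin_char_irr (theta_lin mu' lam).
have neq_t : t != t'.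
  by apply: contra neq_mu => /eqP ett; case: (@theta_inj mu mu' lam lam) => [|->//];
    rewrite deft deft' ett.
have NRes : 'Res[S] 'chi_i \is a character by rewrite cfRes_char ?irr_char.
have : t \in irr_constt ('Res[S] 'chi_i).
  by rewrite -constt_Ind_Res -deft.
case/(constt_charP _ NRes)=> psi Npsi defRes.
have : t' \in irr_constt psi.
  have : t' \in irr_constt ('Res[S] 'chi_i) by rewrite -constt_Ind_Res -deft'.
  by rewrite defRes !irr_consttE cfdotDl cfdot_irr (negPf neq_t) add0r.
case/(constt_charP _ Npsi)=> phi Nphi defpsi.
have := arm_cfdot_theta lam0 ci.
rewrite -(cfResRes _ sTS sSU) defRes defpsi !raddfD /= -deft -deft' !theta_Res.
rewrite !cfdotDl -defi Psi1 divff ?indexUS_neq0 //.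
set L := cfSdprod _ _; have -> : '['Res[T] L] = 1.
  have /irrP[r ->] := lin_char_irr (cfRes_lin_char T (lam_lin lam)).
  exact: cfnorm_irr.
have /natrP[n ->] : '['Res[T] phi, 'Res[T] L] \in Num.nat.
  exact: Cnat_cfdot_char (cfRes_char T Nphi) (cfRes_char T (lin_charW (lam_lin lam))).
by move/eqP; rewrite -subr_eq0 addrC addKr nat1r pnatr_eq0.
Qed.

(** With lambda the central character on X and L its inflation, some constituent t of chi on S has a
    nonzero product with L on T. Then t times the conjugate of L is trivial on T and supplies mu. *)
Lemma arm_Psi_surj i : i \in arm_irr ->
  exists mu lam, lam != 0 /\ arm_Psi mu lam = 'chi_i.
Proof.
move=> Ai; have /setIdP[kerK XnK] := Ai.
have sXZ : X \subset 'Z('chi_i)%CF.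
  by apply: subset_trans (arm_sub_center kerK); rewrite joing_subr.
have [xi linxi resZ] := cfcenter_Res 'chi_i.
have xiX a : a \in X -> 'chi_i a = 'chi_i 1%g * xi a.
  move=> Xa; rewrite -(cfResE _ (cfcenter_sub _) (subsetP sXZ a Xa)) resZ.
  by rewrite cfunE.
have /irrP[lam deflam] := lin_char_irr (cfRes_lin_char X linxi).
have eqX a : a \in X -> 'chi_i a = 'chi_i 1%g * 'chi_lam a.
  by move=> Xa; rewrite xiX // -deflam (cfResE xi sXZ Xa).
have lam0 : lam != 0.
  apply: contra XnK => /eqP lam0; apply/subsetP=> a Xa.
  by rewrite cfkerEirr inE eqX // lam0 irr0 cfun1E Xa mulr1.
set L := cfSdprod defS 'chi_lam; have linL : L \is a linear_char := lam_lin lam.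
have : '['Res[T] 'chi_i, 'Res[T] L] != 0.
  rewrite arm_cfdot // ?mulf_neq0 ?invr_eq0 ?indexUS_neq0 ?irr1_neq0 //.
    exact: subset_trans sKN (cfker_sdprod _ _).
  by move=> a Xa; rewrite /= eqX // cfSdprodEr.
have NRes : 'Res[S] 'chi_i \is a character by rewrite cfRes_char ?irr_char.
rewrite -(cfResRes _ sTS sSU) ['Res[S] _]cfun_sum_constt.
rewrite linear_sum cfdot_suml => /= nz.
have [t ct nzt] : exists2 t, t \in irr_constt ('Res[S] 'chi_i)
    & '['Res[T] 'chi_t, 'Res[T] L] != 0.
  apply/exists_inP; apply: contraNT nz; rewrite negb_exists_in => /forall_inP t0.
  rewrite big1 // => t ct; rewrite linearZ cfdotZl /=.
  by have := t0 t ct; rewrite negbK => /eqP->; rewrite mulr0.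
have linLc : L^*%CF \is a linear_char by rewrite cfConjC_lin_char.
have /irrP[s defs] := mul_lin_irr linLc (mem_irr t).
(* T is normal in S, so an irreducible character whose restriction to T contains the trivial one has
   T in its kernel. *)
have kerT : T \subset cfker 'chi_s.
  apply: constt0_Res_cfker => //; rewrite irr_consttE irr0 -defs; move: nzt.
  rewrite !cfdotE; congr (_ * _ != 0); apply: eq_bigr => y Ty.
  by rewrite !cfResE // !cfunE cfun1E Ty conjC1 mulr1 mulrC.
exists (quo_Iirr T s), lam; split=> //.
have defth : theta (quo_Iirr T s) lam = 'chi_t.
  rewrite /theta quo_IirrE // cfQuoK // -defs mulrAC mulrC [_ * L]mulrC.
  by rewrite mul_conjC_lin_char // mulr1.
apply: Psi_constt => //.
by rewrite /arm_Psi -/(theta _ _) defth constt_Ind_Res.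
Qed.

Definition arm_index (ml : Iirr (S / T) * Iirr X) := cfIirr (arm_Psi ml.1 ml.2).

Lemma card_arm_irr : #|arm_irr| = (#|S : T|%g * (#|X| - 1))%N.
Proof.
have idxE mu lam : lam != 0 -> 'chi_(arm_index (mu, lam)) = arm_Psi mu lam.
  by move=> lam0; rewrite cfIirrE //; have [i _ ->] := arm_Psi_irr mu lam0; apply: mem_irr.
have -> : arm_irr = arm_index @: setX setT [set~ 0].
  apply/setP=> i; apply/idP/imsetP=> [/arm_Psi_surj[mu [lam [lam0 e]]] | [[mu lam]]].
    by exists (mu, lam); rewrite ?inE //; apply: irr_inj; rewrite idxE.
  case/setXP=> _; rewrite [lam \in _]inE in_set1 => lam0 ->.
  have [j Aj e] := arm_Psi_irr mu lam0.
  by rewrite (irr_inj (etrans (idxE mu lam lam0) e)).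
rewrite card_in_imset ?cardsX ?cardsT ?cardsC1.
  rewrite !card_Iirr_abelian ?ab_quo // subn1 card_quotient //.
  by rewrite normal_norm.
move=> [mu lam] [mu' lam'] /setXP[_ +] /setXP[_ +]; rewrite !inE => lam0 lam'0 /= e.
have := idxE mu lam lam0; rewrite e idxE // => /esym/arm_Psi_inj[] // -> -> //.
Qed.

Lemma arm_irr1 i : i \in arm_irr -> 'chi_i 1%g = #|U : S|%g%:R.
Proof. by case/arm_Psi_surj=> mu [lam [_ <-]]; apply: Psi1. Qed.

End ArmLeg.

(** * Pattern subgroups *)

(** Modulo D the generators commute, hence so do the groups they generate. *)
Lemma gen_comm_subG (gT : finGroupType) (A B : {set gT}) (D : {group gT}) :
  <<A>>%g \subset 'N(D)%g -> <<B>>%g \subset 'N(D)%g ->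
  (forall a b, a \in A -> b \in B -> [~ a, b]%g \in D) ->
  [~: <<A>>, <<B>>]%g \subset D.
Proof.
move=> nDA nDB commAB; have [nA nB] := (subset_trans (subset_gen A) nDA,
  subset_trans (subset_gen B) nDB).
rewrite -quotient_cents2 // !quotient_gen // gen_subG centsC gen_subG centsC.
rewrite quotient_cents2 // gen_subG; apply/subsetP=> _ /imset2P[a b Aa Bb ->].
exact: commAB.
Qed.

Section RootElements.
Variables (gT : finGroupType) (F : finFieldType) (x : posroot -> F -> gT).
Hypothesis relx : root_relations x.
Hypothesis fact_neq0 : forall k, (k < 4)%N -> (k`!)%:R != 0 :> F.

Definition gen_by (A : {set posroot}) : {group gT} :=
  <<\bigcup_(g in A) [set x g t | t : F]>>%G.
Definition pgrp (p : pattern) := gen_by [set g | p g].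
Implicit Types p r : pattern.

Lemma mem_root p g t : p g -> x g t \in pgrp p.
Proof.
move=> pg; apply: mem_gen; apply/bigcupP; exists g; first by rewrite inE.
exact: imset_f.
Qed.

Lemma pgrp_subP p (G : {group gT}) :
  reflect (forall g t, p g -> x g t \in G) (pgrp p \subset G).
Proof.
rewrite gen_subG; apply: (iffP bigcupsP) => [subG g t pg | xG g].
  by apply: (subsetP (subG g _)); rewrite ?inE // imset_f.
by rewrite inE => pg; apply/subsetP=> _ /imsetP[t _ ->]; exact: xG.
Qed.

Lemma pgrp_sub p r : psub p r -> pgrp p \subset pgrp r.
Proof.
move/pallP=> pr; apply/pgrp_subP=> g t pg; apply: mem_root.
by have /implyP-> := pr g.
Qed.

Lemma root0 g : x g 0 = 1%g.
Proof. by apply: (mulIg (x g 0)); rewrite (rootD relx) addr0 mul1g. Qed.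

Lemma comm_mem a b (d : pattern) t u : commin a b d -> [~ x a t, x b u]%g \in pgrp d.
Proof.
move/pallP=> abd; have dg g : x g (comm_coord a b g t u) \in pgrp d.
  have := abd g; rewrite /comm_coord; case: comm_monomial => c [i j] /=.
  have [-> _ | _] := eqVneq c 0; first by rewrite mul0r root0.
  by move=> dg; apply: mem_root.
by rewrite (root_comm relx) !groupM.
Qed.

Lemma pcommP p r (d : pattern) a b : pcomm p r d -> p a -> r b -> commin a b d.
Proof. by move/pallP/(_ a)/pallP/(_ b)/implyP=> prd pa rb; apply: prd; rewrite pa. Qed.

Lemma pgrp_norm p r : pnormal p r -> pgrp r \subset 'N(pgrp p)%g.
Proof.
case/andP=> _ prp; apply/pgrp_subP=> b u rb; rewrite inE -genJ gen_subG.
apply/subsetP=> _ /imsetP[y /bigcupP[a pa /imsetP[t _ ->]] ->].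
rewrite conjg_mulR groupM //; rewrite inE in pa; first exact: mem_root.
by apply: comm_mem; apply: (pcommP prp).
Qed.

Lemma pgrp_normal p r : pnormal p r -> (pgrp p <| pgrp r)%g.
Proof. by move=> npr; rewrite /normal pgrp_norm // pgrp_sub //; case/andP: npr. Qed.

Lemma pgrp_comm p r (d s : pattern) : pnormal d s -> psub p s -> psub r s -> pcomm p r d ->
  [~: pgrp p, pgrp r]%g \subset pgrp d.
Proof.
move=> /pgrp_norm nds /pgrp_sub ps /pgrp_sub rs prd.
apply: gen_comm_subG; try exact: subset_trans nds.
move=> y z /bigcupP[a pa /imsetP[t _ ->]] /bigcupP[b rb /imsetP[u _ ->]].
by rewrite !inE in pa rb; apply: comm_mem; apply: pcommP prd pa rb.
Qed.

Lemma pgrpU p r : (pgrp p <*> pgrp r)%g = pgrp (fun g => p g || r g).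
Proof.
have pl : psub p (fun g => p g || r g) by apply/pallP=> g; apply/implyP=> ->.
have pr : psub r (fun g => p g || r g).
  by apply/pallP=> g; apply/implyP=> ->; rewrite orbT.
apply/eqP; rewrite eqEsubset join_subG !pgrp_sub //=.
apply/pgrp_subP=> g t /orP[] gp.
  by rewrite (subsetP (joing_subl _ _)) ?mem_root.
by rewrite (subsetP (joing_subr _ _)) ?mem_root.
Qed.

Lemma root_grp_subP g (G : {group gT}) :
  reflect (forall t, x g t \in G) (pgrp (peq^~ g) \subset G).
Proof.
apply: (iffP (pgrp_subP _ _)) => [inG t | inG h t]; last by rewrite peqE => /eqP->.
by apply: inG; rewrite /peq.
Qed.

Lemma root_grpP g y : y \in pgrp (peq^~ g) -> exists t, y = x g t.
Proof.
have Xg : group_set [set x g t | t : F].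
  apply/group_setP; split; first by apply/imsetP; exists 0; rewrite ?root0.
  by move=> _ _ /imsetP[t _ ->] /imsetP[u _ ->]; rewrite (rootD relx) imset_f.
have : pgrp (peq^~ g) \subset Group Xg.
  by apply/root_grp_subP=> t; apply: imset_f.
by move/subsetP=> sub /sub/imsetP[t _ ->]; exists t.
Qed.

Definition supported p (t : posroot -> F) := forall g, ~~ p g -> t g = 0.

(* Peeling off X_{k+1}, which normalises the later root subgroups of p. *)
Lemma pgrp_from p g k y :
  (forall h, pfrom k h -> h = g \/ pfrom k.+1 h) ->
  pnormal (fun h => p h && pfrom k.+1 h) (fun h => p h && pfrom k h) ->
  y \in pgrp (fun h => p h && pfrom k h) ->
  exists t, (~~ p g -> t = 0) /\
    exists2 z, z \in pgrp (fun h => p h && pfrom k.+1 h) & y = (x g t * z)%g.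
Proof.
move=> kg /pgrp_norm nrm Py; set N := pgrp (fun h => p h && pfrom k.+1 h) in nrm *.
have [pg | pg] := boolP (p g && pfrom k g); last first.
  exists 0; split=> //; exists y; last by rewrite root0 mul1g.
  move: Py; apply/subsetP: y; apply/pgrp_subP=> h t /andP[ph kh]; apply: mem_root.
  by case: (kg h kh) => [eh|->]; [case/negP: pg; rewrite -eh ph | rewrite ph].
have : pgrp (fun h => p h && pfrom k h) \subset (pgrp (peq^~ g) * N)%g.
  have nXN : pgrp (peq^~ g) \subset 'N(N)%g.
    by apply: (subset_trans _ nrm); apply/root_grp_subP=> t; apply: mem_root.
  rewrite -norm_joinEl //.
  apply/pgrp_subP=> h t /andP[ph kh]; case: (kg h kh) => [->|k1h].
    by apply: (subsetP (joing_subl _ _)); apply: mem_root; rewrite /peq.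
  by apply: (subsetP (joing_subr _ _)); apply: mem_root; rewrite ph.
move/subsetP/(_ y Py)/mulsgP=> [w z /root_grpP[t ->] Nz ->].
exists t; split; last by exists z.
by case/andP: pg => ->.
Qed.

(** Normal form: the root subgroups are peeled off in increasing order. With [elt_inj] it yields
    intersections and orders of pattern subgroups. *)
Lemma pgrp_elt p y :
  pnormal p p -> y \in pgrp p -> exists2 t, supported p t & y = elt x t.
Proof.
move=> npp Py.
have nrm k : pnormal (fun h => p h && pfrom k.+1 h) (fun h => p h && pfrom k h).
  move: npp; rewrite /pnormal => /andP[_ cpp]; apply/andP; split.
    by apply/pallP=> g; apply/implyP=> /andP[->]; apply: ltnW.
  apply/pallP=> a; apply/pallP=> b; apply/implyP=> /andP[/andP[pa ka] /andP[pb kb]].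
  apply/pallP=> g; have /pallP/(_ g) := pcommP cpp pa pb.
  case: eqP => //= n0 ->; move: n0 ka kb.
  (* Commutators do not lower the index of their first entry; beyond index 5 there are no roots and
     the claim is vacuous. *)
  have : pall (fun a => pall (fun b => pall (fun g => all (fun k =>
    ((comm_monomial a b g).1 != 0) ==> pfrom k.+1 a ==> pfrom k b ==> pfrom k.+1 g)
    (iota 0 6)))) by vm_compute.
  move/pallP/(_ a)/pallP/(_ b)/pallP/(_ g)/allP/(_ k); rewrite mem_iota.
  have [k6 | k6 _ _ ka] := ltnP k 6; last first.
    have : (k < 6)%N by apply: leq_trans ka _; case: (a).
    by rewrite ltnNge k6.
  by move=> /(_ isT)/implyP imp /eqP/imp/implyP imp2 /imp2/implyP imp3 /imp3.
have Py0 : y \in pgrp (fun h => p h && pfrom 0 h).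
  by move: Py; apply/subsetP: y; apply: pgrp_sub; apply/pallP=> g; rewrite andbT implybb.
have [|t1 [z1 [y1 Py1 e1]]] := pgrp_from (g := a1) _ (nrm 0%N) Py0.
  by case; auto.
have [|t2 [z2 [y2 Py2 e2]]] := pgrp_from (g := a2) _ (nrm 1%N) Py1.
  by case; auto.
have [|t3 [z3 [y3 Py3 e3]]] := pgrp_from (g := a3) _ (nrm 2%N) Py2.
  by case; auto.
have [|t4 [z4 [y4 Py4 e4]]] := pgrp_from (g := a4) _ (nrm 3%N) Py3.
  by case; auto.
have [|t5 [z5 [y5 Py5 e5]]] := pgrp_from (g := a5) _ (nrm 4%N) Py4.
  by case; auto.
have [|t6 [z6 [y6 Py6 e6]]] := pgrp_from (g := a6) _ (nrm 5%N) Py5.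
  by case; auto.
exists (fun g => match g with a1 => t1 | a2 => t2 | a3 => t3 | a4 => t4 | a5 => t5
  | a6 => t6 end); first by case.
have y61 : y6 = 1%g.
  have sub1 : pgrp (fun h => p h && pfrom 6 h) \subset 1%G.
    by apply/pgrp_subP; case=> t /andP[].
  by apply/set1gP/(subsetP sub1).
by rewrite /elt e1 e2 e3 e4 e5 e6 y61 mulg1 !mulgA.
Qed.

Lemma elt_pgrp p t : supported p t -> elt x t \in pgrp p.
Proof.
move=> st; have xt g : x g (t g) \in pgrp p.
  have [pg | pg] := boolP (p g); first exact: mem_root.
  by rewrite st // root0.
by rewrite !groupM.
Qed.

Lemma pgrpI p r : pnormal p p -> pnormal r r ->
  pgrp p :&: pgrp r \subset pgrp (fun g => p g && r g).
Proof.
move=> np nr; apply/subsetP=> y /setIP[/(pgrp_elt np)[t st ->] /(pgrp_elt nr)[s ss es]].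
apply: elt_pgrp => g; rewrite negb_and => /orP[/st // | /ss].
by rewrite (elt_inj relx es).
Qed.

Lemma card_pgrp p : pnormal p p -> #|pgrp p| = (#|F| ^ count p posroots)%N.
Proof.
move=> np; pose q0 := pffun_on (0 : F) [pred g | p g] predT.
have count_card : count p posroots = #|[pred g | p g]|.
  rewrite -size_filter -(card_uniqP _) => [|]; last first.
    apply: filter_uniq; rewrite -(map_inj_uniq (f := rcoord)) //; by case; case.
  apply: eq_card => g; rewrite mem_filter !inE andb_idr // => _.
  by case: g; rewrite eqxx ?orbT.
have -> : pgrp p = (fun t : {ffun posroot -> F} => elt x t) @: q0 :> {set _}.
  apply/setP=> y; apply/idP/imsetP=> [/(pgrp_elt np)[t st ->] | [t /pffun_onP[st _] ->]].
    exists [ffun g => t g]; last by rewrite /elt !ffunE.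
    apply/pffun_onP; split=> //; apply/supportP=> g pg; rewrite ffunE st //.
  by apply: elt_pgrp; move/supportP: st.
rewrite card_in_imset ?card_pffun_on ?count_card //.
by move=> t s _ _ /(elt_inj relx) ets; apply/ffunP; apply: ets.
Qed.

(** The coefficient is 1, 2 or 3 up to sign, hence nonzero in F; coordinates before g vanish and
    those after it lie in d. *)
Lemma linked_comm b c g d : linked b c g d -> exists2 k : F, k != 0 &
  forall t u, exists2 y, y \in pgrp d & [~ x b t, x c u]%g = (x g (k * t * u)%R * y)%g.
Proof.
rewrite /linked; case Em: (comm_monomial b c g) => [k [i j]].
case/and4P=> k_small /eqP i1 /eqP j1 /pallP rest; subst i j.
have k0 : k%:~R != 0 :> F.
  have n0 n : n \in [:: 1; 2; 3]%N -> n%:R != 0 :> F.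
    rewrite !inE => /or3P[] /eqP->; rewrite ?oner_eq0 //.
      exact: fact_neq0 (isT : 2 < 4)%N.
    have := fact_neq0 (isT : 3 < 4)%N.
    by rewrite (natrM _ 3 2) mulf_eq0 negb_or => /andP[].
  have := n0 _ k_small; case: (k) => n //=.
  by rewrite NegzE intrN oppr_eq0.
exists k%:~R => // t u; rewrite (root_comm relx).
have gE : comm_coord b c g t u = k%:~R * t * u by rewrite /comm_coord Em !expr1 mulrA.
have low h : (pidx h < pidx g)%N -> x h (comm_coord b c h t u) = 1%g.
  have := rest h; rewrite /comm_coord; case: (comm_monomial b c h) => l [m n] /=.
  case/or3P=> [/eqP-> | /eqP | /andP[_ lt_gh] lt_hg].
  - by rewrite mul0r root0.
  - by case: (h); case: (g).
  by have := ltn_trans lt_gh lt_hg; rewrite ltnn.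
have high h : (pidx g < pidx h)%N -> x h (comm_coord b c h t u) \in pgrp d.
  have := rest h; rewrite /comm_coord; case: (comm_monomial b c h) => l [m n] /=.
  case/or3P=> [/eqP-> | /eqP | /andP[dh _] _]; last exact: mem_root.
    by rewrite mul0r root0.
  by case: (h); case: (g).
case: g {rest} Em gE low high => Em gE low high.
- by move: Em k0; case: (b); case: (c) => -[<-]; rewrite eqxx.
- by move: Em k0; case: (b); case: (c) => -[<-]; rewrite eqxx.
- exists (x a4 (comm_coord b c a4 t u) * x a5 (comm_coord b c a5 t u)
          * x a6 (comm_coord b c a6 t u))%g; first by rewrite !groupM ?high.
  by rewrite gE !mulgA.
- exists (x a5 (comm_coord b c a5 t u) * x a6 (comm_coord b c a6 t u))%g.
    by rewrite !groupM ?high.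
  by rewrite gE (low a3) // mul1g !mulgA.
- exists (x a6 (comm_coord b c a6 t u)); first by rewrite high.
  by rewrite gE (low a3) // (low a4) // !mul1g.
- by exists 1%g; rewrite ?group1 // gE (low a3) // (low a4) // (low a5) // !mul1g mulg1.
Qed.

(** The leading coordinate k u s takes the value a at s = a / (k u). *)
Lemma linked_conj b c g d u a : linked b c g d -> u != 0 ->
  exists s, exists2 y, y \in pgrp d & (x b u ^ x c s = x b u * x g a * y)%g.
Proof.
case/linked_comm=> k k0 comm u0; have [y dy e] := comm u (a / (k * u)).
exists (a / (k * u)), y => //; rewrite conjg_mulR e mulgA.
by rewrite [_ * (a / _)]mulrC divfK ?mulf_neq0.
Qed.

Lemma linked_mem b c g d (H : {group gT}) : linked b c g d ->
  pgrp d \subset H -> (forall t u, [~ x b t, x c u]%g \in H) ->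
  forall t, x g t \in H.
Proof.
case/linked_comm=> k k0 comm /subsetP sdH inH t.
have [y dy e] := comm 1 (t / k).
have := inH 1 (t / k); rewrite e (groupMr _ (sdH y dy)).
by rewrite mulr1 mulrC divfK.
Qed.

Lemma root_commute b c t u :
  pall (fun h => (comm_monomial b c h).1 == 0) -> commute (x b t) (x c u).
Proof.
move/pallP=> c0; apply/commgP; rewrite (root_comm relx).
have coord0 h : comm_coord b c h t u = 0.
  have := c0 h; rewrite /comm_coord; case: comm_monomial => k [i j] /eqP /= ->.
  by rewrite mul0r.
by rewrite !coord0 !root0 !mulg1.
Qed.

(** This supplies [vanT]. For the simple roots T = K X. Otherwise z reduces y to its leg part, and
    an arm root subgroup conjugates it through all of X_al modulo K. *)
Lemma leg_conj al y : y \in pgrp (tkerp al) ->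
  y \notin (pgrp (kp al) <*> pgrp (peq^~ al))%g ->
  exists2 z, z \in (pgrp (kp al) <*> pgrp (peq^~ al))%g &
  forall a, a \in pgrp (peq^~ al) -> exists2 w, w \in pgrp allp &
  exists2 k, k \in pgrp (kp al) & ((y * z) ^ w = y * z * a * k)%g.
Proof.
rewrite pgrpU -/(centerp al) => Ty Cy.
have [|t st ey] := pgrp_elt _ Ty; first by case: al {Ty Cy}.
have one b c : linked b c al (kp al) ->
    (exists2 v, v \in pgrp (centerp al) & y = (x b (t b) * v)%g) ->
    exists2 z, z \in pgrp (centerp al) &
    forall a, a \in pgrp (peq^~ al) -> exists2 w, w \in pgrp allp &
    exists2 k, k \in pgrp (kp al) & ((y * z) ^ w = y * z * a * k)%g.
  move=> lnk [v Cv yv]; have u0 : t b != 0.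
    by apply: contraNneq Cy => u0; rewrite yv u0 root0 mul1g.
  exists v^-1%g; rewrite ?groupV // => _ /root_grpP[a ->].
  have [s [k Kk e]] := linked_conj a lnk u0.
  exists (x c s); first by rewrite mem_root.
  by exists k; rewrite // yv mulgK.
have t0 g : ~~ tkerp al g -> t g = 0 by apply: st.
move: Ty Cy one ey t0 {st}; case: al => Ty Cy one ey t0.
- by case/negP: Cy; apply: subsetP Ty; rewrite pgrp_sub.
- by case/negP: Cy; apply: subsetP Ty; rewrite pgrp_sub.
- apply: (one a2 a1) => //.
  exists (x a3 (t a3) * x a4 (t a4) * x a5 (t a5) * x a6 (t a6))%g.
    by rewrite !groupM ?mem_root.
  by rewrite ey /elt (t0 a1) // root0 mul1g !mulgA.
- apply: (one a3 a1) => //.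
  exists (x a4 (t a4) * x a5 (t a5) * x a6 (t a6))%g.
    by rewrite !groupM ?mem_root.
  by rewrite ey /elt (t0 a1) // (t0 a2) // !root0 !mul1g !mulgA.
- apply: (one a4 a1) => //.
  exists (x a5 (t a5) * x a6 (t a6))%g; first by rewrite !groupM ?mem_root.
  by rewrite ey /elt (t0 a1) // (t0 a2) // (t0 a3) // !root0 !mul1g !mulgA.
have ey' : y = (x a4 (t a4) * x a5 (t a5) * x a6 (t a6))%g.
  by rewrite ey /elt (t0 a1) // (t0 a2) // (t0 a3) // !root0 !mul1g.
(* The leg of [a6] has two roots: if the [a4] coordinate vanishes, [a5] is paired with [a2];
   otherwise [a4] is paired with [a3], whose root subgroup commutes with that of [a5]. *)
have [t40 | t40] := eqVneq (t a4) 0.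
  apply: (one a5 a2) => //; exists (x a6 (t a6)); first by rewrite mem_root.
  by rewrite ey' t40 root0 mul1g.
exists (x a6 (t a6))^-1%g; first by rewrite groupV mem_root.
move=> _ /root_grpP[a ->].
have lnk : linked a4 a3 a6 (kp a6) by vm_compute.
have [s [k Kk e]] := linked_conj a lnk t40.
exists (x a3 s); first by rewrite mem_root.
have k1 : k = 1%g.
  apply/set1gP; apply: subsetP Kk; apply/(pgrp_subP _ 1%G); by case.
exists 1%g; rewrite ?group1 // mulg1 ey' mulgK conjMg e k1 mulg1.
have -> : (x a5 (t a5) ^ x a3 s = x a5 (t a5))%g.
  have /commgP/eqP c53 := @root_commute a5 a3 (t a5) s isT.
  by rewrite conjg_mulR c53 mulg1.
by rewrite -!mulgA; congr (_ * _)%g; apply: root_commute.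
Qed.

(** * Root subgroups in the centre of a character *)

Section CentralRoots.
Variables (U : {group gT}) (i : Iirr U).
Hypothesis xU : forall g t, x g t \in U.
Local Notation ker := (cfker 'chi_i).
Local Notation Z := ('Z('chi_i)%CF).
Local Notation Xg g := (pgrp (peq^~ g)).

Lemma center_comm_ker b c t u : Xg b \subset Z -> [~ x b t, x c u]%g \in ker.
Proof.
rewrite sub_cfcenter_irr; last by apply/root_grp_subP.
by rewrite commGC => /subsetP; apply; rewrite mem_commg ?xU ?mem_root // /peq.
Qed.

Lemma center_linked b c g d : linked b c g d -> pgrp d \subset ker ->
  Xg b \subset Z -> Xg g \subset ker.
Proof.
move=> lnk dker Zb; apply/root_grp_subP; apply: (linked_mem lnk dker) => t u.
exact: center_comm_ker.
Qed.

Lemma ker_center g : Xg g \subset ker -> Xg g \subset Z.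
Proof. by move/subset_trans; apply; apply: normal_sub (cfker_center_normal _). Qed.

Let F2 : 2%:R != 0 :> F. Proof. exact: fact_neq0 (isT : 2 < 4)%N. Qed.
Let F6 : 6%:R != 0 :> F. Proof. exact: fact_neq0 (isT : 3 < 4)%N. Qed.

Lemma comm_drop6 b c t u : Xg b \subset Z -> Xg a6 \subset ker ->
  (x a3 (comm_coord b c a3 t u) * x a4 (comm_coord b c a4 t u)
   * x a5 (comm_coord b c a5 t u))%g \in ker.
Proof.
move=> Zb /root_grp_subP ker6; have := center_comm_ker c t u Zb.
by rewrite (root_comm relx) groupMr.
Qed.

(* Multiplying [x_2(u), x_1(1)] by [x_2(u), x_1(-1)] isolates the coordinate of
   even degree in the second variable. *)
Lemma center2_ker4 : Xg a2 \subset Z -> Xg a6 \subset ker ->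
  Xg a4 \subset ker.
Proof.
move=> Z2 ker6; apply/root_grp_subP=> v; pose u := v / 2%:R.
have := comm_drop6 a1 u (-1) Z2 ker6; have := comm_drop6 a1 u 1 Z2 ker6.
rewrite /comm_coord /= !expr1 !expr1n !mulr1 !mulrN1 !mul1r !mulN1r.
rewrite sqrrN expr1n -signr_odd /= expr1 mulrN1 !opprK !mulr1 => kA kB.
(* Conjugation moves the [a3] factor to the end, where it cancels in the product with the other
   commutator. *)
have kC : (x a4 u * x a5 (- u) * x a3 (- u))%g \in ker.
  have Ux : x a3 (- u) \in U by rewrite xU.
  rewrite -(memJ_norm _ (subsetP (cfker_norm 'chi_i) _ Ux)) in kA.
  move: kA; rewrite conjgE -!mulgA mulKg !mulgA; exact.
have := groupM kC kB; rewrite !mulgA -[(_ * x a3 u)%g]mulgA (rootD relx) addNr root0 mulg1.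
rewrite -[(_ * x a4 u)%g]mulgA (@root_commute a5 a4) // !mulgA.
rewrite (rootD relx) -mulgA (rootD relx) addNr root0 mulg1.
by rewrite -mulr2n -mulr_natr divfK.
Qed.

(** Modulo [a6], the commutators of x_3(u) with x_1(1) and x_1(-1) have opposite [a4] coordinates
    and the same [a5] coordinate 3u, so their product is x_5(6u). *)
Lemma center3_ker5 : Xg a3 \subset Z -> Xg a6 \subset ker ->
  Xg a5 \subset ker.
Proof.
move=> Z3 ker6; apply/root_grp_subP=> v; pose u := v / 6%:R.
have := comm_drop6 a1 u (-1) Z3 ker6; have := comm_drop6 a1 u 1 Z3 ker6.
rewrite /comm_coord /= !mul0r !root0 !mul1g !expr1 sqrrN !expr1n !mulr1 mulrN1 => kA kB.
have := groupM kA kB; rewrite !mulgA -[(_ * x a4 _)%g]mulgA (@root_commute a5 a4) // !mulgA.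
rewrite (rootD relx) -mulrDr subrr mulr0 root0 mul1g (rootD relx) -mulrDr -mulr2n.
by rewrite -[(3%:Z)%:~R]/(3%:R : F) mulr_natl -mulrnA -mulr_natr divfK.
Qed.

(** If X_g is central modulo the kernel, its commutators lie in the kernel; in each case they reach
    X_al, directly or through an intermediate root. *)
Lemma noncentral_ker al g : ~~ kp al g -> ~~ peq g al -> pgrp (kp al) \subset ker ->
  Xg g \subset Z -> Xg al \subset ker.
Proof.
move=> nk ng kerK Zg; have k6 : kp al a6 -> Xg a6 \subset ker.
  by move=> k6; apply: subset_trans kerK; apply/root_grp_subP=> t; rewrite mem_root.
have lnk b c : linked b c al (kp al) -> Xg b \subset Z -> Xg al \subset ker.
  by move=> l; apply: center_linked l kerK.
case: al nk ng kerK k6 lnk => nk ng kerK k6 lnk; case: g nk ng Zg => // _ _ Zg.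
- exact: (lnk a1 a2).
- exact: (lnk a2 a1).
- exact: (lnk a1 a3).
- by apply: center2_ker4 => //; apply: k6.
- exact: (lnk a3 a1).
- exact: (lnk a1 a4).
(* X_2 central puts X_4 in the kernel, and [X_4, X_1] then gives X_5. *)
- by apply: (lnk a4 a1) => //; apply: ker_center; apply: center2_ker4 => //; apply: k6.
- by apply: center3_ker5 => //; apply: k6.
- exact: (lnk a4 a1).
(* X_1 central puts X_5 = [X_1, X_4] in the kernel modulo [kp a6], and [X_5, X_2] gives X_6. *)
- apply: (lnk a5 a2) => //; apply: ker_center.
  by apply: (@center_linked a1 a4 a5 (kp a6)).
- exact: (lnk a2 a5).
- exact: (lnk a3 a4).
- exact: (lnk a4 a3).
- exact: (lnk a5 a2).
Qed.

End CentralRoots.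

End RootElements.

(** * Root subgroups of G_2 *)

Section RootGroups.
Variables (F : finFieldType).
Hypothesis fact_neq0 : forall k, (k < 4)%N -> (k`!)%:R != 0 :> F.
Local Notation x := (@xroot F).
Local Notation pgrp := (pgrp x).
Let relx : root_relations x := xroot_relations fact_neq0.

Lemma eq_pgrp (A : {set posroot}) (p : pattern) : A =i p -> P F A = pgrp p.
Proof. by move=> eqA; congr (gen_by x _); apply/setP=> g; rewrite eqA inE. Qed.

Lemma UG2E : UG2 F = pgrp allp.
Proof. by apply: eq_pgrp => g; rewrite inE. Qed.
Lemma SgrpE al : Sgrp F al = pgrp (sourcep al).
Proof. by apply: eq_pgrp => g; rewrite /source armE !inE. Qed.
Lemma XgrpE al : Xgrp F al = pgrp (peq^~ al).
Proof. by apply: eq_pgrp => g; rewrite inE -peqE. Qed.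
Lemma KgrpE al : P F (kpattern al) = pgrp (kp al).
Proof. by apply: eq_pgrp => g; rewrite kpatternE inE. Qed.
Lemma TkerE al : Tker F al = pgrp (tkerp al).
Proof. by apply: eq_pgrp => g; rewrite legE kpatternE !inE -peqE. Qed.
Lemma XkerE al : Xker F al = pgrp (xkerp al).
Proof. by apply: eq_pgrp => g; rewrite /source armE !inE andbC -peqE. Qed.

Definition grp_eqs := (UG2E, SgrpE, XgrpE, KgrpE, TkerE, XkerE).

Variable al : posroot.

Lemma Sgrp_sub : Sgrp F al \subset UG2 F.
Proof. by rewrite !grp_eqs pgrp_sub //; case: al. Qed.

Lemma Tker_normal : (Tker F al <| Sgrp F al)%g.
Proof. by rewrite !grp_eqs pgrp_normal //; case: al. Qed.

Lemma Xgrp_sub : Xgrp F al \subset Tker F al.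
Proof. by rewrite !grp_eqs pgrp_sub //; case: al. Qed.

Lemma Kgrp_sub : P F (kpattern al) \subset Tker F al.
Proof. by rewrite !grp_eqs pgrp_sub //; case: al. Qed.

Lemma Kgrp_normal : (P F (kpattern al) <| UG2 F)%g.
Proof. by rewrite !grp_eqs pgrp_normal //; case: al. Qed.

Lemma Xgrp_central : [~: UG2 F, Xgrp F al]%g \subset P F (kpattern al).
Proof. by rewrite !grp_eqs (@pgrp_comm _ _ _ relx _ _ _ allp) //; case: al. Qed.

Lemma Xgrp_abelian : abelian (Xgrp F al).
Proof.
rewrite XgrpE; apply/centsP=> _ /(root_grpP relx)[t ->] _ /(root_grpP relx)[u ->].
by rewrite /commute !(rootD relx) addrC.
Qed.

Lemma Sgrp_comm : [~: Sgrp F al, Sgrp F al]%g \subset Tker F al.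
Proof. by rewrite !grp_eqs (@pgrp_comm _ _ _ relx _ _ _ (sourcep al)) //; case: al. Qed.

Lemma Xker_sdprod : (Xker F al ><| Xgrp F al)%g = Sgrp F al.
Proof.
have nS : Sgrp F al \subset 'N(Xker F al)%g by rewrite !grp_eqs pgrp_norm //; case: al.
have nX : Xgrp F al \subset 'N(Xker F al)%g.
  exact: subset_trans (subset_trans Xgrp_sub (normal_sub Tker_normal)) nS.
rewrite sdprodE //.
  rewrite -norm_joinEr // !grp_eqs pgrpU; congr (gval (gen_by x _)).
  by apply/setP=> g; rewrite !inE; case: al; case: g.
apply/trivgP; rewrite !grp_eqs; apply: subset_trans (pgrpI relx _ _) _ => //; try by case: al.
by apply/pgrp_subP=> g t; case: al; case: g.
Qed.

Lemma Kgrp_Xker : P F (kpattern al) \subset Xker F al.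
Proof. by rewrite !grp_eqs pgrp_sub //; case: al. Qed.

Lemma index_expn (G H : {group {'GL_14[F]}}) m n : H \subset G ->
  #|G| = (#|F| ^ (n + m))%N -> #|H| = (#|F| ^ n)%N -> #|G : H|%g = (#|F| ^ m)%N.
Proof.
move=> sHG cG cH; apply/eqP; rewrite -(eqn_pmul2l (cardG_gt0 H)) Lagrange //.
by rewrite cG cH expnD.
Qed.

Lemma index_Sgrp : #|UG2 F : Sgrp F al|%g = (#|F| ^ count (armp al) posroots)%N.
Proof.
apply: (index_expn (n := count (sourcep al) posroots)) Sgrp_sub _ _.
  by rewrite UG2E (card_pgrp relx) //; case: al.
by rewrite SgrpE (card_pgrp relx) //; case: al.
Qed.

Lemma index_Tker : #|Sgrp F al : Tker F al|%g =
  (#|F| ^ (count (sourcep al) posroots - count (tkerp al) posroots))%N.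
Proof.
apply: (index_expn (n := count (tkerp al) posroots)) (normal_sub Tker_normal) _ _.
  by rewrite SgrpE (card_pgrp relx) //; case: al.
by rewrite TkerE (card_pgrp relx) //; case: al.
Qed.

Lemma card_Xgrp : #|Xgrp F al| = #|F|.
Proof. by rewrite XgrpE (card_pgrp relx) //; case: al. Qed.

Lemma KgrpX : (P F (kpattern al) <*> Xgrp F al)%g = pgrp (centerp al).
Proof. by rewrite !grp_eqs pgrpU. Qed.

Lemma card_leg_arm : (#|UG2 F : Sgrp F al|%g *
  #|(P F (kpattern al) <*> Xgrp F al)%g| = #|Tker F al|)%N.
Proof.
rewrite index_Sgrp KgrpX TkerE !(card_pgrp relx) -?expnD //; by case: al.
Qed.

Lemma Kgrp_conj y : y \in Tker F al ->
  y \notin (P F (kpattern al) <*> Xgrp F al)%g ->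
  exists2 z, z \in (P F (kpattern al) <*> Xgrp F al)%g &
  forall a, a \in Xgrp F al -> exists2 w, w \in UG2 F &
  exists2 k, k \in P F (kpattern al) & ((y * z) ^ w = y * z * a * k)%g.
Proof. by rewrite !grp_eqs; apply: leg_conj. Qed.

End RootGroups.

(** * Characters with root support {alpha} *)

Section RootSupport.
Variables (F : finFieldType).
Hypothesis fact_neq0 : forall k, (k < 4)%N -> (k`!)%:R != 0 :> F.
Local Notation x := (@xroot F).
Local Notation pgrp := (pgrp x).
Let relx : root_relations x := xroot_relations fact_neq0.
Variable i : Iirr (UG2 F).
Local Notation ker := (cfker 'chi_i).
Local Notation Z := ('Z('chi_i)%CF).

Lemma Xroot_sub g (H : {group {'GL_14[F]}}) :
  (Xroot F g \subset H) = (Xgrp F g \subset H).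
Proof. by rewrite gen_subG big_set1. Qed.

Lemma mem_rs g : (g \in rs i) = (Xgrp F g \subset Z) && ~~ (Xgrp F g \subset ker).
Proof. by rewrite inE !Xroot_sub. Qed.

Lemma xroot_UG2 g t : x g t \in UG2 F.
Proof. by rewrite UG2E mem_root. Qed.

Lemma Xgrp_UG2 g : Xgrp F g \subset UG2 F.
Proof. by rewrite XgrpE; apply/root_grp_subP=> t; apply: xroot_UG2. Qed.

(** Descending induction: once the later roots of k(al) are in the kernel, X_g is central, and g not
    being in rs(chi) forces X_g into the kernel. *)
Lemma rs_ker al : rs i = [set al] -> pgrp (kp al) \subset ker.
Proof.
move=> rs_al; suff kn n g : (6 - pidx g <= n)%N -> kp al g -> Xgrp F g \subset ker.
  by apply/pgrp_subP=> g t kg; move: (t); apply/root_grp_subP; rewrite -XgrpE;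
    apply: kn (leqnn _) kg.
elim: n g => [|n IHn] g le_n kg; first by move: le_n; case: (g).
have : g \notin rs i by rewrite rs_al inE -peqE; move: kg; case: (al); case: (g).
rewrite mem_rs negb_and negbK => /orP[/negP[] | //].
rewrite sub_cfcenter_irr ?Xgrp_UG2 //.
pose d h := kp al h && pfrom (pidx g).+1 h.
apply: subset_trans (_ : pgrp d \subset ker).
  rewrite UG2E XgrpE (@pgrp_comm _ _ _ relx _ _ _ allp) //.
  - by rewrite /d; move: kg; case: (al); case: (g).
  - by case: (g).
  by rewrite /d; move: kg; case: (al); case: (g).
apply/pgrp_subP=> h t /andP[kh lt_gh]; move: (t); apply/root_grp_subP; rewrite -XgrpE.
apply: IHn kh.
by rewrite -ltnS (leq_trans _ le_n) // ltn_sub2l //; case: (g).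
Qed.

(** Conversely, if K lies in the kernel and X_al does not, X_al is central since [U, X_al] is in K,
    and [noncentral_ker] excludes every other root outside k(al). *)
Lemma Irr_rootE al :
  (i \in Irr_root F al) = (i \in arm_irr (UG2 F) (P F (kpattern al)) (Xgrp F al)).
Proof.
rewrite !inE KgrpE; apply/eqP/andP=> [rs_al | [kerK notX]].
  split; first exact: rs_ker.
  by have : al \in rs i; [rewrite rs_al set11 | rewrite mem_rs => /andP[]].
apply/setP=> g; rewrite mem_rs inE -peqE.
have [kg | nk] := boolP (kp al g).
  have -> : Xgrp F g \subset ker.
    by rewrite XgrpE; apply: subset_trans kerK; apply/root_grp_subP=> t; rewrite mem_root.
  by rewrite andbF; move: kg; case: (al); case: (g).
have [|ng] := boolP (peq g al).
  rewrite peqE => /eqP->; rewrite notX andbT.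
  rewrite sub_cfcenter_irr ?Xgrp_UG2 // (subset_trans (Xgrp_central _ al)) //.
  by rewrite KgrpE.
apply: contraNF notX => /andP[]; rewrite !XgrpE => Zg _.
exact: (noncentral_ker relx fact_neq0 xroot_UG2 nk ng kerK Zg).
Qed.

End RootSupport.

(** * The correspondence and the count of midafis *)

Section Midafis.
Variables (F : finFieldType) (al : posroot).
Hypothesis fact_neq0 : forall k, (k < 4)%N -> (k`!)%:R != 0 :> F.

Lemma Irr_root_arm :
  Irr_root F al = arm_irr (UG2 F) (P F (kpattern al)) (Xgrp F al).
Proof. by apply/setP=> i; apply: Irr_rootE. Qed.

Let sSU := Sgrp_sub F al.
Let nTS := Tker_normal fact_neq0 al.
Let sXT := Xgrp_sub F al.
Let sKT := Kgrp_sub F al.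
Let nKU := Kgrp_normal fact_neq0 al.
Let cXU := Xgrp_central fact_neq0 al.
Let abX := Xgrp_abelian fact_neq0 al.
Let abST := Sgrp_comm fact_neq0 al.
Let defS := Xker_sdprod fact_neq0 al.
Let sKN := Kgrp_Xker F al.
Let card_leg := card_leg_arm fact_neq0 al.
Let van := @Kgrp_conj F fact_neq0 al.

Lemma Psi_irr mu lam : lam != 0 ->
  exists2 i, i \in Irr_root F al & Psi defS mu lam = 'chi_i.
Proof.
rewrite Irr_root_arm.
exact: (arm_Psi_irr sSU nTS sXT sKT nKU cXU abX abST defS sKN card_leg van).
Qed.

Lemma Psi_inj mu mu' lam lam' : lam != 0 -> lam' != 0 ->
  Psi defS mu lam = Psi defS mu' lam' -> mu = mu' /\ lam = lam'.
Proof.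
exact: (arm_Psi_inj sSU nTS sXT sKT nKU cXU abX abST sKN card_leg van).
Qed.

Lemma Psi_surj i : i \in Irr_root F al ->
  exists mu lam, lam != 0 /\ Psi defS mu lam = 'chi_i.
Proof.
rewrite Irr_root_arm.
exact: (arm_Psi_surj sSU nTS sXT sKT nKU cXU abX abST defS sKN card_leg van).
Qed.

(** All members of Irr(UG2)_al have degree |U : S|, so each is a midafi; their number is |S : T| (q
    - 1). *)
Lemma midafisE :
  midafis_are F al
    (#|F| ^ (count (sourcep al) posroots - count (tkerp al) posroots) * (#|F| - 1))
    (#|F| ^ count (armp al) posroots).
Proof.
have deg i : i \in Irr_root F al -> 'chi_i 1%g = #|UG2 F : Sgrp F al|%g%:R.
  rewrite Irr_root_arm.
  exact: (arm_irr1 sSU nTS sXT sKT nKU cXU abX abST defS sKN card_leg van).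
have allmida : Irr_mida F al = Irr_root F al.
  apply/setP=> i; rewrite inE; apply: andb_idr => Ri.
  by apply/forall_inP=> j Rj; rewrite !deg.
rewrite /midafis_are allmida -index_Sgrp // -index_Tker //; split=> //.
rewrite -(card_Xgrp fact_neq0 al) Irr_root_arm.
exact: (card_arm_irr sSU nTS sXT sKT nKU cXU abX abST defS sKN card_leg van).
Qed.

End Midafis.

Unset Implicit Arguments.
Set Strict Implicit.
Set Printing Implicit Defensive.

Theorem proposition8p5 (p e q : nat) (F : finFieldType)
    (p_prime : prime p) (p_gt3 : (3 < p)%N)
    (q_def : q = (p ^ e)%N) (F_card : #|F| = q) :
  (forall al : posroot,
     (Tker F al <| Sgrp F al)%g
     /\ exists defS : (Xker F al ><| Xgrp F al)%g = Sgrp F al,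
        [/\ (forall (mu : Iirr (Tbar F al)) (lam : Iirr (Xgrp F al)),
               lam != 0 ->
               exists2 i : Iirr (UG2 F),
                 i \in Irr_root F al & Psi defS mu lam = 'chi_i),
            (forall (mu mu' : Iirr (Tbar F al)) (lam lam' : Iirr (Xgrp F al)),
               lam != 0 -> lam' != 0 ->
               Psi defS mu lam = Psi defS mu' lam' ->
               mu = mu' /\ lam = lam')
          & (forall i : Iirr (UG2 F), i \in Irr_root F al ->
               exists (mu : Iirr (Tbar F al)) (lam : Iirr (Xgrp F al)),
                 lam != 0 /\ Psi defS mu lam = 'chi_i)])
  /\ midafis_are F a1 (q - 1) 1
  /\ midafis_are F a2 (q - 1) 1
  /\ midafis_are F a3 (q - 1) q
  /\ midafis_are F a4 (q * (q - 1)) q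
  /\ midafis_are F a5 (q ^ 2 * (q - 1)) q
  /\ midafis_are F a6 (q * (q - 1)) (q ^ 2).
Proof.
have charFp : p \in [pchar F] by apply: (card_finPcharP (n := e)); rewrite ?F_card.
(* The factors of k! are at most 3 < p, so p does not divide it. *)
have fact_neq0 k : (k < 4)%N -> (k`!)%:R != 0 :> F.
  rewrite -(dvdn_pcharf charFp); elim: k => [|k IHk] k4.
    by rewrite Euclid_dvd1.
  rewrite factS Euclid_dvdM // negb_or (IHk (ltnW k4)) andbT gtnNdvd //.
  exact: leq_ltn_trans (k4 : k.+1 <= 3)%N p_gt3.
split=> [al|].
  split; first exact: Tker_normal.
  exists (Xker_sdprod fact_neq0 al); split=> [mu lam | mu mu' lam lam' | i].
  - exact: Psi_irr.
  - exact: Psi_inj.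
  - exact: Psi_surj.
have mida al := midafisE al fact_neq0; rewrite F_card in mida.
move: (mida a1) (mida a2) (mida a3) (mida a4) (mida a5) (mida a6).
by rewrite /= /midafis_are !mul1n !expn1.
Qed.
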